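(* Let $d\ge1$ and let $(\mathscr{C},\Sigma^d,\Theta)$ be a $(d+2)$-angulated category with $d$-suspension functor $\Sigma^d$. Then $\mathscr{C}$ has Auslander-Reiten $(d+2)$-angles if and only if $\mathscr{C}$ has a Serre functor $\mathbb{S}$. Moreover, if either of these properties holds, then the action of the Serre functor on objects coincides with $\tau_d\Sigma^d$, that is, $\tau_d=\mathbb{S}\Sigma^{-d}$ on objects: $\tau_dC\simeq\mathbb{S}\Sigma^{-d}C$ for every indecomposable object $C\in\mathscr{C}$.
   Context: Throughout, $k$ is an algebraically closed field and all categories are $k$-linear, Hom-finite and Krull-Schmidt; $(-)^{\ast}=\operatorname{Hom}_k(-,k)$. **$(d+2)$-angulated category.** Let $d\ge 1$ be an integer, $\mathscr{C}$ an additive category and $\Sigma^d\colon\mathscr{C}\to\mathscr{C}$ an automorphism (the $d$-suspension functor; $\Sigma^d$ is a single symbol), with inverse $\Sigma^{-d}$. A $(d+2)$-$\Sigma^d$-sequence is a sequence of morphisms $A_0\xrightarrow{f_0}A_1\xrightarrow{f_1}\cdots\xrightarrow{f_d}A_{d+1}\xrightarrow{f_{d+1}}\Sigma^dA_0$. Its left rotation is $A_1\xrightarrow{f_1}\cdots\xrightarrow{f_d}A_{d+1}\xrightarrow{f_{d+1}}\Sigma^dA_0\xrightarrow{(-1)^d\Sigma^df_0}\Sigma^dA_1$. A morphism from it to $B_0\xrightarrow{g_0}\cdots\xrightarrow{g_d}B_{d+1}\xrightarrow{g_{d+1}}\Sigma^dB_0$ is a tuple $(\varphi_0,\dots,\varphi_{d+1})$,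 $\varphi_i\colon A_i\to B_i$, with $\varphi_{i+1}f_i=g_i\varphi_i$ for $0\le i\le d$ and $\Sigma^d\varphi_0\circ f_{d+1}=g_{d+1}\varphi_{d+1}$. The triple $(\mathscr{C},\Sigma^d,\Theta)$, with $\Theta$ a class of such sequences (called $(d+2)$-angles), is a $(d+2)$-angulated category if: (N1) $\Theta$ is closed under isomorphisms, direct sums and direct summands; for each $A$ the sequence $A\xrightarrow{\mathrm{Id}}A\to0\to\cdots\to0\to\Sigma^dA$ is in $\Theta$; every morphism $f_0\colon A_0\to A_1$ is the first morphism of some $(d+2)$-angle. (N2) A sequence is in $\Theta$ if and only if its left rotation is in $\Theta$. (N3) Given two $(d+2)$-angles $A_0\xrightarrow{f_0}A_1\xrightarrow{f_1}\cdots\xrightarrow{f_d}A_{d+1}\xrightarrow{f_{d+1}}\Sigma^dA_0$ and $B_0\xrightarrow{g_0}B_1\xrightarrow{g_1}\cdots\xrightarrow{g_d}B_{d+1}\xrightarrow{g_{d+1}}\Sigma^dB_0$ and morphisms $\varphi_0\colon A_0\to B_0$, $\varphi_1\colon A_1\to B_1$ with $\varphi_1f_0=g_0\varphi_0$, there are $\varphi_2,\dots,\varphi_{d+1}$ making $(\varphi_0,\dots,\varphi_{d+1})$ a morphism from the first $(d+2)$-angle to the second. (N4) In (N3) the morphisms $\varphi_2,\dots,\varphi_{d+1}$ can be chosen so that the mapping cone $A_1\oplus B_0\to A_2\oplus B_1\to\cdots\to A_{d+1}\oplus B_d\to\Sigma^dA_0\oplus B_{d+1}\to\Sigma^dA_1\oplus\Sigma^dB_0$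 is in $\Theta$, where the maps are $\begin{pmatrix}-f_i&0\\ \varphi_i&g_{i-1}\end{pmatrix}$ for $i=1,\dots,d+1$ followed by $\begin{pmatrix}-\Sigma^df_0&0\\ \Sigma^d\varphi_0&g_{d+1}\end{pmatrix}$. **Serre functor.** A Serre functor on $\mathscr{C}$ is a $k$-linear auto-equivalence $\mathbb{S}\colon\mathscr{C}\to\mathscr{C}$ for which there are isomorphisms $\operatorname{Hom}_{\mathscr{C}}(X,Y)\simeq\operatorname{Hom}_{\mathscr{C}}(Y,\mathbb{S}X)^{\ast}$ natural in $X,Y\in\mathscr{C}$. **Auslander-Reiten $(d+2)$-angles.** $\operatorname{rad}_{\mathscr{C}}$ is the Jacobson radical: $\operatorname{rad}_{\mathscr{C}}(X,Y)=\{g\colon X\to Y\mid \mathrm{Id}_X-hg \text{ is invertible for all } h\colon Y\to X\}$. A morphism $f\colon X\to Y$ is right almost split if $f$ is not a split epimorphism and every morphism $g\colon M\to Y$ that is not a split epimorphism factors through $f$; left almost split is the dual notion. A $(d+2)$-angle $A_0\xrightarrow{\alpha_0}A_1\xrightarrow{\alpha_1}\cdots\xrightarrow{\alpha_d}A_{d+1}\xrightarrow{\alpha_{d+1}}\Sigma^dA_0$ is an Auslander-Reiten $(d+2)$-angle if $\alpha_0$ is left almost split, $\alpha_d$ is right almost split and, when $d\ge2$, also $\alpha_1,\dots,\alpha_{d-1}\in\operatorname{rad}_{\mathscr{C}}$. (Then $A_0$ and $A_{d+1}$ are indecomposable and each determines the other up to isomorphism; one writes $A_0=\tau_dA_{d+1}$.)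 We say $\mathscr{C}$ has Auslander-Reiten $(d+2)$-angles if for every indecomposable object $C$ there is an Auslander-Reiten $(d+2)$-angle with last term $A_{d+1}=C$ and there is an Auslander-Reiten $(d+2)$-angle with first term $A_0=C$. The operation $\tau_d$ is called the $d$-Auslander-Reiten translation. *)

(* Defs.v *)
From mathcomp Require Import all_boot all_order all_algebra.

Set Implicit Arguments.
Unset Strict Implicit.
Unset Printing Implicit Defensive.

Import GRing.Theory.
Local Open Scope ring_scope.

Declare Scope cat_scope.
Delimit Scope cat_scope with cat.
Local Open Scope cat_scope.

(* Hom-finiteness is built in: [vectType k] is the type of finite-dimensional
   k-vector spaces. *)
Record klinCat (k : fieldType) := KLinCat {
  obj :> Type;
  hom : obj -> obj -> vectType k;
  idm : forall X : obj, hom X X;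
  comp : forall X Y Z : obj, hom Y Z -> hom X Y -> hom X Z;
  compA : forall (W X Y Z : obj) (h : hom Y Z) (g : hom X Y) (f : hom W X),
    comp h (comp g f) = comp (comp h g) f;
  comp1m : forall (X Y : obj) (f : hom X Y), comp (idm Y) f = f;
  compm1 : forall (X Y : obj) (f : hom X Y), comp f (idm X) = f;
  comp_linear_r : forall (X Y Z : obj) (g : hom Y Z),
    linear (fun f : hom X Y => comp g f);
  comp_linear_l : forall (X Y Z : obj) (f : hom X Y),
    linear (fun g : hom Y Z => comp g f)
}.

Arguments hom {k} {_} X Y : rename.
Arguments idm {k} {_} X : rename.

Notation "g ∘ f" := (comp g f) (at level 40, left associativity) : cat_scope.

(* A morphism bundled with its source and target.  The equation
   [arr f = arr g] says that [f] and [g] are the same morphism, including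
   equality of their sources and of their targets, when the latter are not
   syntactically equal. *)
Definition arrow (k : fieldType) (C : klinCat k) : Type :=
  {XY : C * C & hom XY.1 XY.2}.

Definition arr (k : fieldType) (C : klinCat k) (X Y : C) (f : hom X Y) :
    arrow C :=
  existT (fun XY : C * C => hom XY.1 XY.2 : Type) (X, Y) f.

Definition is_iso (k : fieldType) (C : klinCat k) (X Y : C) (f : hom X Y) :
    Prop :=
  exists g : hom Y X, g ∘ f = idm X /\ f ∘ g = idm Y.

Definition isomorphic (k : fieldType) (C : klinCat k) (X Y : C) : Prop :=
  exists f : hom X Y, is_iso f.

Definition split_mono (k : fieldType) (C : klinCat k) (X Y : C)
    (f : hom X Y) : Prop :=
  exists g : hom Y X, g ∘ f = idm X.

Definition split_epi (k : fieldType) (C : klinCat k) (X Y : C)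
    (f : hom X Y) : Prop :=
  exists g : hom Y X, f ∘ g = idm Y.

Definition is_zero (k : fieldType) (C : klinCat k) (Z : C) : Prop :=
  (forall (X : C) (f : hom X Z), f = 0) /\
  (forall (X : C) (f : hom Z X), f = 0).

Definition is_biprod (k : fieldType) (C : klinCat k) (X Y Z : C)
    (i1 : hom X Z) (i2 : hom Y Z) : Prop :=
  exists (p1 : hom Z X) (p2 : hom Z Y),
    [/\ p1 ∘ i1 = idm X, p2 ∘ i2 = idm Y, p1 ∘ i2 = 0, p2 ∘ i1 = 0
      & i1 ∘ p1 + i2 ∘ p2 = idm Z].

Definition additive_cat (k : fieldType) (C : klinCat k) : Prop :=
  (exists Z : C, is_zero Z) /\
  (forall X Y : C,
     exists (Z : C) (i1 : hom X Z) (i2 : hom Y Z), is_biprod i1 i2).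

Definition indecomposable (k : fieldType) (C : klinCat k) (X : C) : Prop :=
  ~ is_zero X /\
  forall (Y Z : C) (i1 : hom Y X) (i2 : hom Z X),
    is_biprod i1 i2 -> is_zero Y \/ is_zero Z.

(* The ring End(X) is local: it is nonzero and its non-units are closed
   under addition. *)
Definition local_end (k : fieldType) (C : klinCat k) (X : C) : Prop :=
  idm X <> 0 /\
  forall f g : hom X X, is_iso (f + g) -> is_iso f \/ is_iso g.

Definition krull_schmidt (k : fieldType) (C : klinCat k) : Prop :=
  forall X : C,
    exists (n : nat) (Y : 'I_n -> C)
           (i : forall j, hom (Y j) X) (p : forall j, hom X (Y j)),
      [/\ forall j, p j ∘ i j = idm (Y j),
          forall j l, j != l -> p j ∘ i l = 0,
          \sum_(j < n) i j ∘ p j = idm X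
        & forall j, local_end (Y j)].

Definition in_rad (k : fieldType) (C : klinCat k) (X Y : C) (g : hom X Y) :
    Prop :=
  forall h : hom Y X, is_iso (idm X - h ∘ g).

Definition right_almost_split (k : fieldType) (C : klinCat k) (X Y : C)
    (f : hom X Y) : Prop :=
  ~ split_epi f /\
  forall (M : C) (g : hom M Y), ~ split_epi g ->
    exists h : hom M X, f ∘ h = g.

Definition left_almost_split (k : fieldType) (C : klinCat k) (X Y : C)
    (f : hom X Y) : Prop :=
  ~ split_mono f /\
  forall (M : C) (g : hom X M), ~ split_mono g ->
    exists h : hom Y M, h ∘ f = g.

Record functor (k : fieldType) (C : klinCat k) := Functor {
  fobj :> C -> C;
  fmor : forall X Y : C, hom X Y -> hom (fobj X) (fobj Y);
  fmor_id : forall X : C, fmor (idm X) = idm (fobj X);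
  fmor_comp : forall (X Y Z : C) (g : hom Y Z) (f : hom X Y),
    fmor (g ∘ f) = fmor g ∘ fmor f
}.

Definition klinear_functor (k : fieldType) (C : klinCat k) (F : functor C) :
    Prop :=
  forall X Y : C, linear (fun f : hom X Y => fmor F f).

(* Auto-equivalence: there is a quasi-inverse G, with natural isomorphisms
   a : Id -> G F and b : F G -> Id. *)
Definition equivalence (k : fieldType) (C : klinCat k) (F : functor C) :
    Prop :=
  exists (G : functor C) (a : forall X : C, hom X (G (F X)))
         (b : forall X : C, hom (F (G X)) X),
    [/\ forall X, is_iso (a X),
        forall X, is_iso (b X),
        forall (X Y : C) (f : hom X Y), a Y ∘ f = fmor G (fmor F f) ∘ a X
      & forall (X Y : C) (f : hom X Y), b Y ∘ fmor F (fmor G f) = f ∘ b X].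

(* Automorphism of an additive category: the inverse functor is a strict
   inverse, on objects as well as on morphisms. *)
Record automorphism (k : fieldType) (C : klinCat k) := Automorphism {
  afun :> functor C;
  ainv : functor C;
  afunK : forall (X Y : C) (f : hom X Y), arr (fmor ainv (fmor afun f)) = arr f;
  ainvK : forall (X Y : C) (f : hom X Y), arr (fmor afun (fmor ainv f)) = arr f;
  afunD : forall (X Y : C) (f g : hom X Y),
    fmor afun (f + g) = fmor afun f + fmor afun g
}.

(* [eta X Y f] is a linear form on Hom(Y, S X); [k^o] is k viewed as a vector
   space over itself. *)
Definition is_serre (k : fieldType) (C : klinCat k) (S : functor C) : Prop :=
  [/\ klinear_functor S,
      equivalence S
    & exists eta : forall X Y : C, hom X Y -> 'Hom(hom Y (S X), k^o),
        [/\ forall X Y, linear (eta X Y),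
            forall X Y, bijective (eta X Y)
          & forall (X X' Y Y' : C) (u : hom X' X) (v : hom Y Y')
                   (f : hom X Y) (g : hom Y' (S X')),
              eta X' Y' (v ∘ f ∘ u) g = eta X Y f (fmor S u ∘ g ∘ v)]].

Definition has_serre (k : fieldType) (C : klinCat k) : Prop :=
  exists S : functor C, is_serre S.

(* A (d+2)-Sigma-sequence
     A 0 -> A 1 -> ... -> A d.+1 -> Sigma (A 0).
   Only the terms [A i] with i <= d.+1 and the morphisms [mor A i] with
   i <= d are part of the sequence; the remaining values of the two families
   are irrelevant, are ignored by morphisms of sequences, and hence do not
   matter for any class of sequences that is closed under isomorphisms. *)
Record dseq (k : fieldType) (C : klinCat k) (Sigma : automorphism C)
    (d : nat) := DSeq {
  term :> nat -> C;
  mor : forall i : nat, hom (term i) (term i.+1);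
  conn : hom (term d.+1) (Sigma (term 0%N))
}.

Definition is_left_rotation (k : fieldType) (C : klinCat k)
    (Sigma : automorphism C) (d : nat) (A B : dseq Sigma d) : Prop :=
  [/\ forall i, (i < d)%N -> arr (mor B i) = arr (mor A i.+1),
      arr (mor B d) = arr (conn A)
    & arr (conn B) = arr ((-1) ^+ d *: fmor Sigma (mor A 0%N))].

Definition is_dseq_mor (k : fieldType) (C : klinCat k)
    (Sigma : automorphism C) (d : nat) (A B : dseq Sigma d)
    (phi : forall i, hom (A i) (B i)) : Prop :=
  (forall i, (i <= d)%N -> phi i.+1 ∘ mor A i = mor B i ∘ phi i) /\
  fmor Sigma (phi 0%N) ∘ conn A = conn B ∘ phi d.+1.

Definition dseq_iso (k : fieldType) (C : klinCat k)
    (Sigma : automorphism C) (d : nat) (A B : dseq Sigma d) : Prop :=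
  exists phi : forall i, hom (A i) (B i),
    is_dseq_mor phi /\ forall i, (i <= d.+1)%N -> is_iso (phi i).

(* D is the direct sum of A and B, via inclusions that are morphisms of
   sequences. *)
Definition is_dseq_sum (k : fieldType) (C : klinCat k)
    (Sigma : automorphism C) (d : nat) (A B D : dseq Sigma d) : Prop :=
  exists (iA : forall i, hom (A i) (D i)) (iB : forall i, hom (B i) (D i)),
    [/\ is_dseq_mor iA, is_dseq_mor iB
      & forall i, (i <= d.+1)%N -> is_biprod (iA i) (iB i)].

(* D is the mapping cone of phi : A -> B.  Its terms are A i.+1 (+) B i for
   i <= d, with inclusions [iA i] and [iB i], and Sigma (A 0) (+) B d.+1, with
   inclusions [iA'] and [iB d.+1].  The equations give the columns of the
   matrices of its morphisms; the target Sigma (A 1 (+) B 0) of the last one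
   is the biproduct of Sigma (A 1) and Sigma (B 0) via the images under Sigma
   of the inclusions. *)
Definition is_mapping_cone (k : fieldType) (C : klinCat k)
    (Sigma : automorphism C) (d : nat) (A B : dseq Sigma d)
    (phi : forall i, hom (A i) (B i)) (D : dseq Sigma d) : Prop :=
  exists (iA : forall i, hom (A i.+1) (D i)) (iA' : hom (Sigma (A 0%N)) (D d.+1))
         (iB : forall i, hom (B i) (D i)),
    (forall i, (i <= d)%N -> is_biprod (iA i) (iB i)) /\
    is_biprod iA' (iB d.+1) /\
    (forall i, (i < d)%N ->
      mor D i ∘ iA i = - (iA i.+1 ∘ mor A i.+1) + iB i.+1 ∘ phi i.+1) /\
    mor D d ∘ iA d = - (iA' ∘ conn A) + iB d.+1 ∘ phi d.+1 /\
    (forall i, (i <= d)%N -> mor D i ∘ iB i = iB i.+1 ∘ mor B i) /\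
    conn D ∘ iA' = - (fmor Sigma (iA 0%N) ∘ fmor Sigma (mor A 0%N))
                   + fmor Sigma (iB 0%N) ∘ fmor Sigma (phi 0%N) /\
    conn D ∘ iB d.+1 = fmor Sigma (iB 0%N) ∘ conn B.

Definition axiomN1 (k : fieldType) (C : klinCat k) (Sigma : automorphism C)
    (d : nat) (Theta : dseq Sigma d -> Prop) : Prop :=
  [/\ forall A B, dseq_iso A B -> Theta A -> Theta B,
      forall A B D, is_dseq_sum A B D -> (Theta D <-> Theta A /\ Theta B),
      forall (X : C) (A : dseq Sigma d), arr (mor A 0%N) = arr (idm X) ->
        (forall i, (2 <= i <= d.+1)%N -> is_zero (A i)) -> Theta A
    & forall (X Y : C) (f : hom X Y),
        exists A : dseq Sigma d, Theta A /\ arr (mor A 0%N) = arr f].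

Definition axiomN2 (k : fieldType) (C : klinCat k) (Sigma : automorphism C)
    (d : nat) (Theta : dseq Sigma d -> Prop) : Prop :=
  forall A B, is_left_rotation A B -> (Theta A <-> Theta B).

Definition axiomN3 (k : fieldType) (C : klinCat k) (Sigma : automorphism C)
    (d : nat) (Theta : dseq Sigma d -> Prop) : Prop :=
  forall (A B : dseq Sigma d)
         (phi0 : hom (A 0%N) (B 0%N)) (phi1 : hom (A 1%N) (B 1%N)),
    Theta A -> Theta B -> phi1 ∘ mor A 0%N = mor B 0%N ∘ phi0 ->
    exists phi : forall i, hom (A i) (B i),
      [/\ phi 0%N = phi0, phi 1%N = phi1 & is_dseq_mor phi].

Definition axiomN4 (k : fieldType) (C : klinCat k) (Sigma : automorphism C)
    (d : nat) (Theta : dseq Sigma d -> Prop) : Prop :=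
  forall (A B : dseq Sigma d)
         (phi0 : hom (A 0%N) (B 0%N)) (phi1 : hom (A 1%N) (B 1%N)),
    Theta A -> Theta B -> phi1 ∘ mor A 0%N = mor B 0%N ∘ phi0 ->
    exists phi : forall i, hom (A i) (B i),
      [/\ phi 0%N = phi0, phi 1%N = phi1, is_dseq_mor phi
        & forall D, is_mapping_cone phi D -> Theta D].

Definition angulated (k : fieldType) (C : klinCat k) (Sigma : automorphism C)
    (d : nat) (Theta : dseq Sigma d -> Prop) : Prop :=
  [/\ axiomN1 Theta, axiomN2 Theta, axiomN3 Theta & axiomN4 Theta].

Definition AR_angle (k : fieldType) (C : klinCat k) (Sigma : automorphism C)
    (d : nat) (Theta : dseq Sigma d -> Prop) (A : dseq Sigma d) : Prop :=
  [/\ Theta A,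
      left_almost_split (mor A 0%N),
      right_almost_split (mor A d)
    & forall i, (1 <= i < d)%N -> in_rad (mor A i)].

Definition has_AR_angles (k : fieldType) (C : klinCat k)
    (Sigma : automorphism C) (d : nat) (Theta : dseq Sigma d -> Prop) : Prop :=
  forall X : C, indecomposable X ->
    (exists A, AR_angle Theta A /\ A d.+1 = X) /\
    (exists A, AR_angle Theta A /\ A 0%N = X).

(* T = tau_d X.  This is a relation since tau_d X is only determined up to
   isomorphism. *)
Definition is_tau (k : fieldType) (C : klinCat k) (Sigma : automorphism C)
    (d : nat) (Theta : dseq Sigma d -> Prop) (X T : C) : Prop :=
  exists A, [/\ AR_angle Theta A, A d.+1 = X & A 0%N = T].

(* Main.v *)
From HB Require Import structures.
Require Import Defs.
From mathcomp Require Import all_boot all_order all_algebra.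
From mathcomp Require Import boolp.
(* [hom] must denote morphisms of a category again, not the [hom] of [vector]. *)
Import Defs.

(** The notion that ties the two sides together is Serre duality at a single
    object: [Z] is paired with [X] when some linear form on Hom(X, Z) makes
    composition a perfect pairing Hom(X, Y) x Hom(Y, Z) -> k for all [Y]
    ([serre_paired]).  Such a [Z] is unique up to isomorphism ([pair_unique]),
    and a Serre functor exists if and only if every object occurs on the left
    and on the right of such a pair ([pairs_serre], [serre_serre_paired],
    [serre_surj]).

    From angles to pairs.  In an Auslander-Reiten angle A_0 -> ... -> A_(d+1),
    every nonzero morphism out of A_(d+1) and every nonzero morphism into
    Sigma A_0 divides the connecting morphism ([AR_linking]): this follows from the
    almost split property, because every morphism is a weak cokernel and a weak
    kernel, as completing it to an angle shows.  Therefore any linear form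
    that does not vanish at the connecting morphism pairs A_(d+1) with
    Sigma A_0.  Pairs add up along biproducts, and by the Krull-Schmidt property
    every object is a biproduct of local ones, so angles ending or starting at
    indecomposable objects yield all pairs.

    From pairs to angles.  If [X] is local and paired with [Z], a linear form on
    End(X) that kills the radical but not the identity is represented by a
    morphism h : X -> Z with h g = 0 for all g that are not split epimorphisms
    and g h = 0 for all g that are not split monomorphisms ([pair_socle]).
    By exactness, an angle with connecting morphism [h] begins with a left
    almost split morphism and ends with a right almost split one
    ([socle_almost_split]).  Its inner maps may fail to be radical, but then the
    angle has a direct summand Y -> Y in inner positions; splitting it off lowers
    the total dimension of the endomorphism algebras of the terms, so finitely
    many steps lead to an Auslander-Reiten angle ([minimal_AR_angle]).

    The formula for the translation.  The divisibility property of the connecting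
    morphism A_(d+1) -> Sigma A_0 passes to its desuspension, so A_0 is paired
    with Sigma^-1 A_(d+1), and uniqueness of the pairs identifies it with
    S (Sigma^-1 A_(d+1)) ([tau_serre]). *)

Set Implicit Arguments.
Unset Strict Implicit.
Unset Printing Implicit Defensive.

Import GRing.Theory.
Local Open Scope ring_scope.
Local Open Scope cat_scope.

(** * Isomorphisms and local objects *)

Section Category.
Variables (k : fieldType) (C : klinCat k).
Implicit Types V W X Y Z : C.

Lemma compDr X Y Z (g : hom Y Z) : {morph (fun f : hom X Y => g ∘ f) : a b / a + b}.
Proof. by move=> a b; have := comp_linear_r g 1 a b; rewrite !scale1r. Qed.

Lemma compDl X Y Z (f : hom X Y) : {morph (fun g : hom Y Z => g ∘ f) : a b / a + b}.
Proof. by move=> a b; have := comp_linear_l f 1 a b; rewrite !scale1r. Qed.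

Lemma comp0r X Y Z (g : hom Y Z) : g ∘ (0 : hom X Y) = 0.
Proof. by apply: (addrI (g ∘ 0)); rewrite -compDr !addr0. Qed.

Lemma comp0l X Y Z (f : hom X Y) : (0 : hom Y Z) ∘ f = 0.
Proof. by apply: (addrI (0 ∘ f)); rewrite -compDl !addr0. Qed.

Lemma compZr X Y Z (g : hom Y Z) (f : hom X Y) a : g ∘ (a *: f) = a *: (g ∘ f).
Proof. by rewrite -[a *: f]addr0 comp_linear_r comp0r addr0. Qed.

Lemma compZl X Y Z (g : hom Y Z) (f : hom X Y) a : (a *: g) ∘ f = a *: (g ∘ f).
Proof. by rewrite -[a *: g]addr0 (comp_linear_l f) comp0l addr0. Qed.

Lemma compNr X Y Z (g : hom Y Z) (f : hom X Y) : g ∘ (- f) = - (g ∘ f).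
Proof. by rewrite -scaleN1r compZr scaleN1r. Qed.

Lemma compNl X Y Z (g : hom Y Z) (f : hom X Y) : (- g) ∘ f = - (g ∘ f).
Proof. by rewrite -scaleN1r compZl scaleN1r. Qed.

Lemma compBr X Y Z (g : hom Y Z) (f f' : hom X Y) : g ∘ (f - f') = g ∘ f - g ∘ f'.
Proof. by rewrite compDr compNr. Qed.

Lemma compBl X Y Z (g g' : hom Y Z) (f : hom X Y) : (g - g') ∘ f = g ∘ f - g' ∘ f.
Proof. by rewrite compDl compNl. Qed.

Lemma compACA V W X Y Z (a : hom Y Z) (b : hom X Y) (c : hom W X) (e : hom V W) :
  (a ∘ b) ∘ (c ∘ e) = a ∘ (b ∘ c) ∘ e.
Proof. by rewrite !compA. Qed.

Lemma iso_id X : is_iso (idm X).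
Proof. by exists (idm X); rewrite comp1m. Qed.

Lemma iso_comp X Y Z (g : hom Y Z) (f : hom X Y) :
  is_iso g -> is_iso f -> is_iso (g ∘ f).
Proof.
move=> [g' [g'g gg']] [f' [f'f ff']]; exists (f' ∘ g'); split.
  by rewrite compA -(compA f') g'g compm1.
by rewrite compA -(compA g) ff' compm1.
Qed.

Lemma iso_inv X Y (f : hom X Y) : is_iso f ->
  exists g, [/\ is_iso g, g ∘ f = idm X & f ∘ g = idm Y].
Proof. by move=> [g [gf fg]]; exists g; split=> //; exists f. Qed.

Lemma iso_cancel_l X Y Z (g : hom Y Z) (a b : hom X Y) :
  is_iso g -> g ∘ a = g ∘ b -> a = b.
Proof.
by move=> [h [hg _]] /(congr1 (fun u => h ∘ u)); rewrite !compA hg !comp1m.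
Qed.

Lemma iso_cancel_r X Y Z (f : hom X Y) (a b : hom Y Z) :
  is_iso f -> a ∘ f = b ∘ f -> a = b.
Proof.
by move=> [h [_ fh]] /(congr1 (fun u => u ∘ h)); rewrite -!compA fh !compm1.
Qed.

Lemma isomorphic_sym X Y : isomorphic X Y -> isomorphic Y X.
Proof. by move=> [f /iso_inv[g [gi _ _]]]; exists g. Qed.

Lemma isomorphic_trans X Y Z :
  isomorphic X Y -> isomorphic Y Z -> isomorphic X Z.
Proof. by move=> [f fi] [g gi]; exists (g ∘ f); apply: iso_comp. Qed.

Lemma isomorphic_refl X : isomorphic X X.
Proof. by exists (idm X); apply: iso_id. Qed.

Lemma is_zero_idm X : idm X = 0 -> is_zero X.
Proof.
move=> e; split=> Y f; first by rewrite -(comp1m f) e comp0l.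
by rewrite -(compm1 f) e comp0r.
Qed.

Lemma local_iso X Y : isomorphic X Y -> local_end X -> local_end Y.
Proof.
move=> [u [v [vu uv]]] [id0 loc]; split=> [e|f g fgi].
  by apply: id0; rewrite -vu -(comp1m u) e comp0l comp0r.
have vi : is_iso v by exists u.
have ui : is_iso u by exists v.
have conj (f' : hom Y Y) : is_iso (v ∘ f' ∘ u) -> is_iso f'.
  move=> i; have -> : f' = u ∘ (v ∘ f' ∘ u) ∘ v.
    by rewrite !compA uv comp1m -compA uv compm1.
  by do 2?apply: iso_comp.
case: (loc (v ∘ f ∘ u) (v ∘ g ∘ u)).
- by rewrite -compDl -compDr; do 2?apply: iso_comp.
- by left; apply: conj.
- by right; apply: conj.
Qed.

Lemma local_sub1 X (f : hom X X) : local_end X -> ~ is_iso f -> is_iso (idm X - f).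
Proof.
move=> [_ loc] nf; have [] // := loc f (idm X - f).
by rewrite addrC subrK; apply: iso_id.
Qed.

Lemma local_sum X (I : finType) (F : I -> hom X X) :
  local_end X -> is_iso (\sum_i F i) -> exists i, is_iso (F i).
Proof.
move=> [id0 loc]; rewrite -big_enum; elim: (enum I) => [|i s IH].
  by rewrite big_nil => -[g []]; rewrite comp0r => /esym.
by rewrite big_cons => /loc [Fi|/IH]; first by exists i.
Qed.

Lemma local_indec X : local_end X -> indecomposable X.
Proof.
move=> [id0 loc]; split=> [[z _]|Y Z i1 i2 [p1 [p2 [e1 e2 e12 e21 es]]]].
  by apply: id0; apply: z.
have [[g [_ h]]|[g [_ h]]] : is_iso (i1 ∘ p1) \/ is_iso (i2 ∘ p2).
- by apply: loc; rewrite es; apply: iso_id.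
- by right; apply: is_zero_idm; rewrite -e2 -(compm1 p2) -h !compA e21 !comp0l.
- by left; apply: is_zero_idm; rewrite -e1 -(compm1 p1) -h !compA e12 !comp0l.
Qed.

Lemma biprod_zero_iso X Y Z (i1 : hom X Z) (i2 : hom Y Z) :
  is_biprod i1 i2 -> is_zero Y -> is_iso i1.
Proof.
move=> [p1 [p2 [e1 e2 e12 e21 es]]] [_ z]; exists p1; split=> //.
by rewrite -es (z _ i2) comp0l addr0.
Qed.

End Category.

(** * Consequences of the Krull-Schmidt property *)

Section Splitting.
Variables (k : fieldType) (C : klinCat k).
Hypotheses (Cadd : additive_cat C).
Implicit Types X Y Z W : C.

Section Partial.
Variables (X : C) (n : nat) (Y : 'I_n -> C)
  (i : forall j, hom (Y j) X) (p : forall j, hom X (Y j)).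
Hypotheses (pi1 : forall j, p j ∘ i j = idm (Y j))
  (pi0 : forall j l, j != l -> p j ∘ i l = 0).

(** The idempotent attached to a subfamily [s] of the summands of [X] splits.
    The auxiliary predicate [Q] rides along the induction, so that the lemma
    doubles as the engine of an induction over Krull-Schmidt decompositions. *)
Lemma partial_sum_split (Q : C -> Prop) (s : seq 'I_n) : uniq s ->
  (forall Z, is_zero Z -> Q Z) -> (forall j, j \in s -> Q (Y j)) ->
  (forall A B D (i1 : hom A D) (i2 : hom B D), is_biprod i1 i2 ->
     Q A -> Q B -> Q D) ->
  exists (W : C) (w : hom W X) (q : hom X W),
    [/\ Q W, q ∘ w = idm W & w ∘ q = \sum_(l <- s) i l ∘ p l].
Proof.
move=> + Q0 + Qs; elim: s => [_ _|l s IH /= /andP[ls us] QY].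
  have [Z Zz] := proj1 Cadd; exists Z, 0, 0; split; first exact: Q0.
    by rewrite (proj2 Zz _ (idm Z)) comp0l.
  by rewrite comp0r big_nil.
have QYs j : j \in s -> Q (Y j) by move=> js; apply: QY; rewrite inE js orbT.
have [W [w [q [QW qw wq]]]] := IH us QYs.
have plw : p l ∘ w = 0.
  rewrite -(compm1 w) -qw !compA -(compA _ w) wq.
  rewrite (big_morph _ (compDr (p l)) (comp0r _ _)) big1_seq ?comp0l // => m /= ms.
  by rewrite compA pi0 ?comp0l //; apply: contraNneq ls => ->.
have qil : q ∘ i l = 0.
  rewrite -(comp1m q) -qw -!compA (compA w) wq.
  rewrite (big_morph _ (compDl (i l)) (comp0l _ _)) big1_seq ?comp0r // => m /= ms.
  by rewrite -compA pi0 ?comp0r //; apply: contraNneq ls => <-.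
have [D [i1 [i2 b]]] := proj2 Cadd (Y l) W.
have QD : Q D by apply: Qs b _ QW; apply: QY; rewrite inE eqxx.
have [p1 [p2 [e1 e2 e12 e21 es]]] := b.
exists D, (i l ∘ p1 + w ∘ p2), (i1 ∘ p l + i2 ∘ q); split=> //.
  rewrite compDl !compDr !compACA pi1 plw qil qw !compm1 !comp0r !comp0l.
  by rewrite addr0 add0r.
rewrite big_cons -wq compDl !compDr !compACA e1 e2 e12 e21.
by rewrite !compm1 !comp0r !comp0l addr0 add0r.
Qed.
End Partial.

Hypothesis CKS : krull_schmidt C.

Lemma krull_schmidt_ind (Q : C -> Prop) :
  (forall Z, is_zero Z -> Q Z) -> (forall X, local_end X -> Q X) ->
  (forall A B D (i1 : hom A D) (i2 : hom B D), is_biprod i1 i2 ->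
     Q A -> Q B -> Q D) ->
  forall X, Q X.
Proof.
move=> Q0 Ql Qs X; have [n [Y [i [p [pi1 pi0 es loc]]]]] := CKS X.
have [W [w [q [QW qw wq]]]] := partial_sum_split pi1 pi0 (Q := Q)
  (enum_uniq 'I_n) Q0 (fun j _ => Ql _ (loc j)) Qs.
have [Z Zz] := proj1 Cadd; apply: (Qs W Z X w 0) QW (Q0 _ Zz).
exists q, 0; split=> //; rewrite ?comp0l ?comp0r //.
  by rewrite (proj2 Zz _ (idm Z)).
by rewrite addr0 wq big_enum es.
Qed.

(** A split monomorphism [a] from a local object has a complement that lies in the
    kernel of the prescribed retraction [b].  By the exchange argument, [a]
    identifies [Y] with one of the Krull-Schmidt summands [Z j], whose
    complement is known; a shear along [a] and [b] then turns that complement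
    into one killed by [b]. *)
Lemma local_complement X Y (a : hom Y X) (b : hom X Y) :
  local_end Y -> b ∘ a = idm Y ->
  exists (W : C) (w : hom W X) (q : hom X W),
    [/\ q ∘ w = idm W, b ∘ w = 0, q ∘ a = 0 & a ∘ b + w ∘ q = idm X].
Proof.
move=> loc ba; have [n [Z [i [p [pi1 pi0 es locZ]]]]] := CKS X.
have [j bia] : exists j, is_iso (b ∘ i j ∘ (p j ∘ a)).
  apply: (local_sum loc); rewrite (eq_bigr (fun j => b ∘ (i j ∘ p j) ∘ a)).
    rewrite -(big_morph _ (compDl a) (comp0l _ _)).
    rewrite -(big_morph _ (compDr b) (comp0r _ _)).
    by rewrite es compm1 ba; apply: iso_id.
  by move=> j _; rewrite !compA.
have [W [w [q [_ qw wq]]]] := partial_sum_split pi1 pi0 (Q := fun=> True)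
  (s := [seq l <- enum 'I_n | l != j])
  (filter_uniq _ (enum_uniq _)) (fun _ _ => I) (fun _ _ => I)
  (fun _ _ _ _ _ _ _ _ => I).
have {}wq : w ∘ q = idm X - i j ∘ p j.
  rewrite wq big_filter big_enum_cond /=.
  by have := es; rewrite (bigD1 j) //= => <-; rewrite addrC addrK.
have [c [cl _]] := bia.
have [v vpa] : exists v, v ∘ (p j ∘ a) = idm Y.
  by exists (c ∘ (b ∘ i j)); rewrite -compA cl.
have [u uE] : exists u, u = v ∘ p j by exists (v ∘ p j).
have ua : u ∘ a = idm Y by rewrite uE -compA.
(* Z j is local, so its nonzero idempotent (p j ∘ a) ∘ v is the identity. *)
have pav : p j ∘ a ∘ v = idm (Z j).
  set e := _ ∘ v; have ve : v ∘ e = v by rewrite /e compA vpa comp1m.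
  case: (proj2 (locZ j) e (idm _ - e)).
  - by rewrite addrC subrK; apply: iso_id.
  - move=> ei; apply: (iso_cancel_l ei); rewrite compm1.
    by rewrite {1}/e -compA ve.
  - move=> fi; case: (proj1 loc); rewrite -vpa.
    have -> : v = 0; last by rewrite comp0l.
    by apply: (iso_cancel_r fi); rewrite compBr compm1 ve subrr comp0l.
have uw : u ∘ w = 0.
  rewrite uE -compA -(compm1 w) -qw (compA w) wq (compA (p j)) compBr.
  by rewrite compm1 (compA (p j)) pi1 comp1m subrr comp0l comp0r.
have qiw : q ∘ i j = 0.
  rewrite -(comp1m q) -qw -(compA q) wq -compA compBl comp1m.
  by rewrite -(compA (i j)) pi1 compm1 subrr comp0r.
exists W, (w - a ∘ b ∘ w), (q - q ∘ a ∘ u); split.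
- rewrite compBr !compBl -!compA uw (compA u) ua comp1m.
  by rewrite qw !comp0r subrr !subr0.
- by rewrite compBr !compA ba comp1m subrr.
- by rewrite compBl -!compA ua compm1 subrr.
have -> : (w - a ∘ b ∘ w) ∘ (q - q ∘ a ∘ u) =
    (idm X - a ∘ b) ∘ (w ∘ q) ∘ (idm X - a ∘ u).
  by rewrite !compBl !compBr !comp1m !compm1 !compA.
rewrite wq -compA.
have -> : (idm X - i j ∘ p j) ∘ (idm X - a ∘ u) = idm X - a ∘ u.
  rewrite compBl comp1m compBr compm1 -compA (compA (p j)).
  by rewrite (_ : p j ∘ a ∘ u = p j) ?subrr ?subr0 // uE compA pav comp1m.
rewrite compBl comp1m compBr compm1 -compA (compA b) ba comp1m.
by rewrite opprB (addrA (idm X - _)) subrK addrCA subrr addr0.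
Qed.

Lemma indec_local X : indecomposable X -> local_end X.
Proof.
move=> [Xz dec]; have [n [Z [i [p [pi1 pi0 es loc]]]]] := CKS X.
case: n Z i p pi1 pi0 es loc => [|n] Z i p pi1 pi0 es loc.
  by case: Xz; apply: is_zero_idm; rewrite -es big_ord0.
have [W [w [q [qw bw qa e]]]] := local_complement (loc ord0) (pi1 ord0).
have b : is_biprod (i ord0) w by exists (p ord0), q.
case: (dec _ _ _ _ b) => z; first by case: (proj1 (loc ord0)); apply: (proj1 z).
by apply: local_iso (loc ord0); exists (i ord0); apply: biprod_zero_iso b z.
Qed.

Lemma in_rad_compl X Y Z (g : hom Y Z) (f : hom X Y) : in_rad f -> in_rad (g ∘ f).
Proof. by move=> fr h; rewrite compA. Qed.

(** Jacobson's identity: if [v] inverts [1 - gf] then [1 + fvg] inverts [1 - fg].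
    It makes the radical, defined by a one-sided condition, a two-sided ideal. *)
Lemma iso_sub1_comp X Y (f : hom X Y) (g : hom Y X) :
  is_iso (idm X - g ∘ f) -> is_iso (idm Y - f ∘ g).
Proof.
move=> [v [vl vr]]; exists (idm Y + f ∘ v ∘ g); split.
  have /(congr1 (fun t => f ∘ t ∘ g)) := vl.
  rewrite compBr compm1 compBr compBl compm1 => E.
  rewrite compDl comp1m compBr compm1 -[RHS]addr0 -addrA; congr (_ + _).
  by rewrite -{1}E !compA addrC subrr.
have /(congr1 (fun t => f ∘ t ∘ g)) := vr.
rewrite compBl comp1m compBr compBl compm1 => E.
rewrite compDr compm1 compBl comp1m -[RHS]addr0 -addrA; congr (_ + _).
by rewrite -{1}E !compA addrC subrr.
Qed.

Lemma in_rad_compr X Y Z (g : hom Y Z) (f : hom X Y) : in_rad g -> in_rad (g ∘ f).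
Proof.
by move=> gr h; rewrite compA; apply: iso_sub1_comp; rewrite compA; apply: gr.
Qed.

Lemma in_radD X Y (f g : hom X Y) : in_rad f -> in_rad g -> in_rad (f + g).
Proof.
move=> fr gr h; have [u [ui uf fu]] := iso_inv (fr h).
have -> : idm X - h ∘ (f + g) = (idm X - h ∘ f) ∘ (idm X - u ∘ h ∘ g).
  by rewrite [RHS]compBr compm1 !compA fu comp1m compDr opprD addrA.
by apply: iso_comp; [apply: fr | apply: gr].
Qed.

Lemma in_rad0 X Y : in_rad (0 : hom X Y).
Proof. by move=> h; rewrite comp0r subr0; apply: iso_id. Qed.

(** Otherwise every [f ∘ i j], with [i j] the inclusion of a Krull-Schmidt summand
    of [X], would be radical, because non-isomorphisms of the local object
    [Z j] are quasi-invertible; summing over [j], so would [f]. *)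
Lemma not_in_rad_local X Y (f : hom X Y) : ~ in_rad f ->
  exists (Z : C) (a : hom Z X) (b : hom Y Z), local_end Z /\ b ∘ f ∘ a = idm Z.
Proof.
move=> nf; apply: contrapT => H; apply: nf.
have [n [Z [i [p [_ _ es loc]]]]] := CKS X.
rewrite -(compm1 f) -es (big_morph _ (compDr f) (comp0r _ _)).
apply: big_ind => [|g g'|j _]; [exact: in_rad0 | exact: in_radD |].
rewrite compA; apply: in_rad_compr => h; apply: (local_sub1 (loc j)) => -[c [cl _]].
by apply: H; exists (Z j), (i j), (c ∘ h); rewrite -!compA in cl *.
Qed.

End Splitting.

(** * Linear forms and perfect pairings *)

Section LinearAlgebra.
Variables (k : fieldType).
Implicit Types V W : vectType k.

Lemma linear_lfun V W (f : V -> W) : linear f -> exists F : 'Hom(V, W), F =1 f.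
Proof.
move=> lf; pose L := GRing.isLinear.Build k V W *:%R f lf.
pose g : {linear V -> W} := HB.pack f L.
by exists (linfun g) => v; rewrite lfunE.
Qed.

Lemma inj_dim_le V W (f : 'Hom(V, W)) : injective f -> (dim V <= dim W)%N.
Proof.
move=> /lker0P/eqP fi; rewrite -(dimvf V) -(dimvf W).
by rewrite -(limg_dim_eq (f := f)) ?dimvS ?subvf // fi capv0.
Qed.

Lemma inj_dim_surj V W (f : 'Hom(V, W)) : injective f -> (dim W <= dim V)%N ->
  forall w, exists v, f v = w.
Proof.
move=> /lker0P/eqP fi le w.
have /eqP e : limg f == fullv.
  by rewrite eqEdim subvf /= dimvf limg_dim_eq ?dimvf // fi capv0.
by have /memv_imgP[v _ ->] : w \in limg f; [rewrite e memvf | exists v].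
Qed.

Lemma dual_nonzero V (v : V) : v != 0 -> exists psi : 'Hom(V, k^o), psi v = 1.
Proof.
move=> v0; have [i ci] : exists i, coord (vbasis fullv) i v != 0.
  apply/existsP; apply: contraNT v0 => /existsPn H.
  rewrite (coord_vbasis (memvf v)) big1 // => i _.
  by move: (H i); rewrite negbK => /eqP ->; rewrite scale0r.
have [|F FE] := @linear_lfun V k^o (fun u =>
  (coord (vbasis fullv) i v)^-1 *: (coord (vbasis fullv) i u : k^o)).
  by move=> a x y; rewrite linearP scalerDr !scalerA mulrC.
by exists F; rewrite FE /GRing.scale /= mulVf.
Qed.

(** [P] carves out a linear subspace; a maximal subspace contained in it is all of
    it, and projecting along a complement separates [v] from it. *)
Lemma dual_separate V (P : V -> Prop) (v : V) :
  P 0 -> (forall a b, P a -> P b -> P (a + b)) -> (forall c a, P a -> P (c *: a)) ->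
  ~ P v -> exists psi : 'Hom(V, k^o), psi v = 1 /\ forall u, P u -> psi u = 0.
Proof.
move=> P0 PD PZ Pv.
pose inP (U : {vspace V}) := forall u, u \in U -> P u.
have [U [UP Umax]] : exists U, inP U /\ forall u, P u -> u \in U.
  have : exists U, inP U by exists 0%VS => u; rewrite memv0 => /eqP ->.
  case=> U; have [m] := ubnP (\dim {:V} - \dim U)%N.
  elim: m U => // m IH U lem UP.
  have [] := pselect (exists u, P u /\ u \notin U); last first.
    move=> H; exists U; split=> // u Pu; apply: contrapT => /negP nu.
    by apply: H; exists u.
  move=> [u [Pu nu]]; apply: (IH (U + <[u]>)%VS).
    have lt : (\dim U < \dim (U + <[u]>))%N.
      rewrite ltn_neqAle dimvS ?addvSl // andbT; apply: contra nu => /eqP e.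
      have /eqP -> : U == (U + <[u]>)%VS by rewrite eqEdim addvSl -e leqnn.
      by apply: (subvP (addvSr _ _)); apply: memv_line.
    apply: leq_trans (_ : _ < \dim {:V} - \dim U)%N _; last by rewrite -ltnS.
    by rewrite ltn_sub2l // (leq_trans lt) // dimvS ?subvf.
  move=> w /memv_addP[x xU [y /vlineP[c ->] ->]].
  by apply: PD; [apply: UP | apply: PZ].
have : v - projv U v != 0.
  rewrite subr_eq0; apply/eqP => e; apply: Pv; apply: UP.
  by rewrite e memv_proj.
case/dual_nonzero => psi psi1.
exists (psi \o (\1 - projv U))%VF; split=> [|u /Umax uU].
  by rewrite comp_lfunE add_lfunE opp_lfunE id_lfunE psi1.
by rewrite comp_lfunE add_lfunE opp_lfunE id_lfunE projv_id // subrr linear0.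
Qed.

(** A pairing without left kernel embeds [V] into the dual of [W]; with equal
    dimensions the embedding is onto.  Both halves are used in
    [perfect_pairing], the first one for the transposed pairing. *)
Lemma pairing_dim V W (b : V -> W -> k^o) :
  (forall w, linear (b^~ w)) -> (forall v, linear (b v)) ->
  (forall v, (forall w, b v w = 0) -> v = 0) ->
  (dim V <= dim W)%N /\ ((dim W <= dim V)%N ->
    forall psi : 'Hom(W, k^o), exists v, forall w, psi w = b v w).
Proof.
move=> ll lr nd.
have [F FE] := choice (fun v => linear_lfun (lr v)).
have lF : linear F.
  by move=> a u v; apply/lfunP => w; rewrite !lfunE /= lfunE /= !FE ll.
have [G GE] := linear_lfun lF.
have Gi : injective G.
  move=> u v e; apply/eqP; rewrite -subr_eq0; apply/eqP/nd => w.
  have E : b (-1 *: v + u) w = -1 *: b v w + b u w := ll w (-1) v u.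
  by rewrite addrC -(scaleN1r v) E scaleN1r -!FE -!GE e addNr.
have dd : dim 'Hom(W, k^o) = dim W by rewrite [LHS]muln1.
split; first by rewrite -dd; apply: (inj_dim_le Gi).
move=> le psi; have [|v vE] := inj_dim_surj Gi _ psi; first by rewrite dd.
by exists v => w; rewrite -vE GE FE.
Qed.

Lemma perfect_pairing V W (b : V -> W -> k^o) :
  (forall w, linear (b^~ w)) -> (forall v, linear (b v)) ->
  (forall v, (forall w, b v w = 0) -> v = 0) ->
  (forall w, (forall v, b v w = 0) -> w = 0) ->
  forall psi : 'Hom(W, k^o), exists v, forall w, psi w = b v w.
Proof.
move=> ll lr ndl ndr; have [_ H] := pairing_dim ll lr ndl; apply: H.
by have [] := @pairing_dim W V (fun w v => b v w) lr ll ndr.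
Qed.

End LinearAlgebra.

(** * Serre duality for a pair of objects *)

Section Pairs.
Variables (k : fieldType) (C : klinCat k).
Implicit Types X Y Z : C.

(** [Z] behaves as the value at [X] of a Serre functor: composition followed by
    [phi] is a perfect pairing between Hom(X, Y) and Hom(Y, Z) for every [Y]. *)
Definition serre_pair X Z (phi : 'Hom(hom X Z, k^o)) : Prop :=
  (forall Y (g : hom X Y), (forall f : hom Y Z, phi (f ∘ g) = 0) -> g = 0) /\
  (forall Y (f : hom Y Z), (forall g : hom X Y, phi (f ∘ g) = 0) -> f = 0).

Definition serre_paired X Z : Prop :=
  exists phi : 'Hom(hom X Z, k^o), serre_pair phi.

(** The property that the connecting morphism of an Auslander-Reiten angle is shown
    to have.  It is phrased by composition alone, without scalars, so that it
    can be carried along the additive functor [Sigma]. *)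
Definition linking X Z (h : hom X Z) : Prop :=
  [/\ h <> 0,
      forall Y (g : hom X Y), g <> 0 -> exists f : hom Y Z, f ∘ g = h
    & forall Y (f : hom Y Z), f <> 0 -> exists g : hom X Y, f ∘ g = h].

(** The property of [h] that makes an angle with connecting morphism [h] start
    with a left almost split and end with a right almost split morphism. *)
Definition socle_map X Z (h : hom X Z) : Prop :=
  [/\ h <> 0,
      forall M (g : hom M X), ~ split_epi g -> h ∘ g = 0
    & forall M (g : hom Z M), ~ split_mono g -> g ∘ h = 0].

Lemma linear_compr X Y Z (phi : 'Hom(hom X Z, k^o)) (f : hom Y Z) :
  linear (fun g : hom X Y => phi (f ∘ g)).
Proof. by move=> a u v; rewrite comp_linear_r linearP. Qed.

Lemma linear_compl X Y Z (phi : 'Hom(hom X Z, k^o)) (g : hom X Y) :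
  linear (fun f : hom Y Z => phi (f ∘ g)).
Proof. by move=> a u v; rewrite (comp_linear_l g) linearP. Qed.

Section OnePair.
Variables (X Z : C) (phi : 'Hom(hom X Z, k^o)).
Hypothesis P : serre_pair phi.

Lemma pair_repr Y (psi : hom X Y -> k^o) : linear psi ->
  exists f : hom Y Z, forall g, psi g = phi (f ∘ g).
Proof.
case: P => Pl Pr /linear_lfun[F FE].
have [f fE] := perfect_pairing (b := fun (f : hom Y Z) (g : hom X Y) => phi (f ∘ g))
  (linear_compl phi) (linear_compr phi) (Pr Y) (Pl Y) F.
by exists f => g; rewrite -FE fE.
Qed.

Lemma pair_corepr Y (psi : hom Y Z -> k^o) : linear psi ->
  exists g : hom X Y, forall f, psi f = phi (f ∘ g).
Proof.
case: P => Pl Pr /linear_lfun[F FE].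
have [g gE] := perfect_pairing (b := fun (g : hom X Y) (f : hom Y Z) => phi (f ∘ g))
  (linear_compr phi) (linear_compl phi) (Pl Y) (Pr Y) F.
by exists g => f; rewrite -FE gE.
Qed.

Lemma pair_ext_l Y (f f' : hom Y Z) :
  (forall g : hom X Y, phi (f ∘ g) = phi (f' ∘ g)) -> f = f'.
Proof.
move=> H; apply/eqP; rewrite -subr_eq0; apply/eqP/(proj2 P) => g.
by rewrite compBl linearB /= H subrr.
Qed.

Lemma pair_ext_r Y (g g' : hom X Y) :
  (forall f : hom Y Z, phi (f ∘ g) = phi (f ∘ g')) -> g = g'.
Proof.
move=> H; apply/eqP; rewrite -subr_eq0; apply/eqP/(proj1 P) => f.
by rewrite compBr linearB /= H subrr.
Qed.

(** The pairing matches each endomorphism [s] of [Z] with exactly one endomorphism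
    [t] of [X], compatibly with sums and composites; hence End(Z) and End(X)
    have the same units, and one is local when the other is. *)
Definition transposed (s : hom Z Z) (t : hom X X) : Prop :=
  forall m : hom X Z, phi (s ∘ m) = phi (m ∘ t).

Lemma transposed_r s : exists t, transposed s t.
Proof.
by have [t tE] := pair_corepr (linear_compr phi s); exists t => m; rewrite tE.
Qed.

Lemma transposed_l t : exists s, transposed s t.
Proof.
by have [s sE] := pair_repr (linear_compl phi t); exists s => m; rewrite sE.
Qed.

Lemma transposedD s s' t t' :
  transposed s t -> transposed s' t' -> transposed (s + s') (t + t').
Proof. by move=> st st' m; rewrite compDl compDr !linearD /= st st'. Qed.

Lemma transposedM s s' t t' :
  transposed s t -> transposed s' t' -> transposed (s ∘ s') (t ∘ t').
Proof. by move=> st st' m; rewrite -compA st -compA st' compA. Qed.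

Lemma transposed_id_l s : transposed s (idm X) -> s = idm Z.
Proof. by move=> H; apply: pair_ext_l => m; rewrite H compm1 comp1m. Qed.

Lemma transposed_id_r t : transposed (idm Z) t -> t = idm X.
Proof. by move=> H; apply: pair_ext_r => m; rewrite -H compm1 comp1m. Qed.

Lemma transposed_iso s t : transposed s t -> is_iso s <-> is_iso t.
Proof.
move=> st; split=> [[s' [e1 e2]]|[t' [e1 e2]]].
  have [t' st'] := transposed_r s'; exists t'; split.
    by apply: transposed_id_r; rewrite -e1; apply: transposedM.
  by apply: transposed_id_r; rewrite -e2; apply: transposedM.
have [s' st'] := transposed_l t'; exists s'; split.
  by apply: transposed_id_l; rewrite -e1; apply: transposedM.
by apply: transposed_id_l; rewrite -e2; apply: transposedM.
Qed.

Lemma pair_local : local_end X <-> local_end Z.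
Proof.
split=> -[id0 loc]; split.
- move=> e; apply: id0; apply: pair_ext_r => f.
  by rewrite -(comp1m f) e !comp0l linear0.
- move=> f g; have [t ft] := transposed_r f; have [u gu] := transposed_r g.
  rewrite (transposed_iso ft) (transposed_iso gu).
  by rewrite (transposed_iso (transposedD ft gu)); apply: loc.
- move=> e; apply: id0; apply: pair_ext_l => f.
  by rewrite -(compm1 f) e !comp0r linear0.
- move=> t u; have [f ft] := transposed_l t; have [g gu] := transposed_l u.
  rewrite -(transposed_iso ft) -(transposed_iso gu).
  by rewrite -(transposed_iso (transposedD ft gu)); apply: loc.
Qed.

(** Take a linear form [psi] on the local algebra End(X) that vanishes on the
    non-isomorphisms and not at the identity, and let [h] represent it.  If
    [h ∘ g] is nonzero, some [phi (h ∘ g ∘ f)] is nonzero, so [g ∘ f] is an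
    isomorphism and [g] is a split epimorphism.  On the other side [f ∘ g] is an
    endomorphism of [Z], and transposing it to [X] gives the same conclusion. *)
Lemma pair_socle : local_end X -> exists h : hom X Z, socle_map h.
Proof.
move=> [id0 loc].
have [|||| psi [psi1 psi0]] := dual_separate
  (P := fun f : hom X X => ~ is_iso f) (v := idm X).
- by move=> [g []]; rewrite comp0r => /esym.
- by move=> a b na nb /loc[].
- move=> c a na; have [->|c0] := eqVneq c 0.
    by rewrite scale0r => -[g []]; rewrite comp0r => /esym.
  move=> [g [e1 e2]]; apply: na; exists (c *: g).
  by move: e1 e2; rewrite !compZl !compZr.
- by move=> H; apply: H; apply: iso_id.
have [h hE] := pair_repr (psi := psi) (linearP _).
exists h; split.
- move=> e; have /esym/eqP := hE (idm X).
  by rewrite psi1 e comp0l linear0 eq_sym oner_eq0.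
- move=> M g ng; apply: (proj2 P) => f.
  rewrite -compA -hE psi0 // => -[u [_ gfu]]; apply: ng.
  by exists (f ∘ u); rewrite compA.
- move=> M g ng; apply: (proj1 P) => f.
  have [t st] := transposed_r (f ∘ g).
  rewrite compA st -hE psi0 // => /(transposed_iso st)[u [ufg _]]; apply: ng.
  by exists (u ∘ f); rewrite -compA.
Qed.

End OnePair.

(** Each of the two forms is represented by the other; the representing morphisms
    are mutually inverse because the pairings are nondegenerate. *)
Lemma pair_unique X Z Z' : serre_paired X Z -> serre_paired X Z' -> isomorphic Z Z'.
Proof.
move=> [phi P] [phi' P'].
have [f fE] := pair_repr P' (psi := phi) (linearP _).
have [f' f'E] := pair_repr P (psi := phi') (linearP _).
exists f, f'; split.
  by apply: (pair_ext_l P) => g; rewrite -compA -f'E -fE comp1m.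
by apply: (pair_ext_l P') => g; rewrite -compA -fE -f'E comp1m.
Qed.

Lemma pair_iso X Z Z' : serre_paired X Z -> isomorphic Z Z' -> serre_paired X Z'.
Proof.
move=> [phi [Pl Pr]] [u [v [vu uv]]].
have [phi' phi'E] := linear_lfun (linear_compr phi v).
exists phi'; split=> Y f H.
  apply: Pl => g; have := H (u ∘ g); rewrite phi'E !compA vu comp1m //.
rewrite -(comp1m f) -uv -compA (Pr _ (v ∘ f)) ?comp0r // => g.
by have := H g; rewrite phi'E compA.
Qed.

Lemma pair_biprod X1 X2 X Z1 Z2 Z (i1 : hom X1 X) (i2 : hom X2 X)
    (j1 : hom Z1 Z) (j2 : hom Z2 Z) : is_biprod i1 i2 -> is_biprod j1 j2 ->
  serre_paired X1 Z1 -> serre_paired X2 Z2 -> serre_paired X Z.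
Proof.
move=> [p1 [p2 [pi1 pi2 pi12 pi21 pis]]] [q1 [q2 [qj1 qj2 qj12 qj21 qjs]]].
move=> [phi1 [P1l P1r]] [phi2 [P2l P2r]].
have [|phi phiE] := @linear_lfun _ _ k^o
  (fun m : hom X Z => phi1 (q1 ∘ m ∘ i1) + phi2 (q2 ∘ m ∘ i2)).
  move=> a u v; rewrite !(compDr, compZr, compDl, compZl) !(linearD, linearZZ) /=.
  by rewrite addrACA.
exists phi; split=> Y f H.
  rewrite -(compm1 f) -pis compDr !compA.
  have -> : f ∘ i1 = 0.
    apply: P1l => g; have := H (j1 ∘ g); rewrite phiE -!compA.
    by rewrite (compA q1) qj1 comp1m (compA q2) qj21 comp0l linear0 addr0.
  have -> : f ∘ i2 = 0.
    apply: P2l => g; have := H (j2 ∘ g); rewrite phiE -!compA.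
    by rewrite (compA q2) qj2 comp1m (compA q1) qj12 comp0l linear0 add0r.
  by rewrite !comp0l addr0.
rewrite -(comp1m f) -qjs compDl -!compA.
have -> : q1 ∘ f = 0.
  apply: P1r => g; have := H (g ∘ p1); rewrite phiE !compA -!(compA _ p1).
  by rewrite pi1 compm1 pi12 comp0r linear0 addr0.
have -> : q2 ∘ f = 0.
  apply: P2r => g; have := H (g ∘ p2); rewrite phiE !compA -!(compA _ p2).
  by rewrite pi2 compm1 pi21 comp0r linear0 add0r.
by rewrite !comp0r addr0.
Qed.

Lemma pair_zero X Z : is_zero X -> is_zero Z -> serre_paired X Z.
Proof.
move=> zX zZ; exists 0; split=> Y f _; first exact: (proj2 zX).
exact: (proj1 zZ).
Qed.

(** Any linear form with value 1 at [h] is nondegenerate, since every nonzero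
    morphism out of [X] or into [Z] divides [h]. *)
Lemma linking_pair X Z (h : hom X Z) : linking h -> serre_paired X Z.
Proof.
move=> [/eqP h0 hl hr]; have [phi phi1] := dual_nonzero h0.
have nz : ~ (phi h = 0) by rewrite phi1; apply/eqP; apply: oner_neq0.
exists phi; split=> Y f H; apply: contrapT => f0.
  by have [g e] := hl _ _ f0; apply: nz; rewrite -e.
by have [g e] := hr _ _ f0; apply: nz; rewrite -e.
Qed.

Lemma linking_iso X X' Z Z' (h : hom X Z) (u : hom X' X) (v : hom Z Z') :
  linking h -> is_iso u -> is_iso v -> linking (v ∘ h ∘ u).
Proof.
move=> [h0 hl hr] /iso_inv[u' [u'i u'u uu']] /iso_inv[v' [v'i v'v vv']]; split.
- move=> e; apply: h0; have -> : h = v' ∘ (v ∘ h ∘ u) ∘ u'.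
    by rewrite !compA v'v comp1m -compA uu' compm1.
  by rewrite e comp0r comp0l.
- move=> Y g g0; have [|f fE] := hl _ (g ∘ u').
    by move=> e; apply: g0; rewrite -(compm1 g) -u'u compA e comp0l.
  by exists (v ∘ f); rewrite -fE -!compA u'u compm1.
- move=> Y f f0; have [|g gE] := hr _ (v' ∘ f).
    by move=> e; apply: f0; rewrite -(comp1m f) -vv' -compA e comp0r.
  by exists (g ∘ u); rewrite -gE !compA vv' comp1m.
Qed.

End Pairs.

(** * Serre functors from pairs of objects *)

Lemma full_faithful_equivalence (k : fieldType) (C : klinCat k) (S : functor C) :
  (forall X Y (s : hom (S X) (S Y)), exists u : hom X Y, fmor S u = s) ->
  (forall X Y (u v : hom X Y), fmor S u = fmor S v -> u = v) ->
  (forall Y, exists X, isomorphic (S X) Y) -> equivalence S.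
Proof.
move=> full faith surj.
have [g gP] := choice surj.
pose b Y := projT1 (cid (gP Y)); pose bP Y := projT2 (cid (gP Y)) : is_iso (b Y).
pose b' Y := projT1 (cid (bP Y)).
have b'b Y : b' Y ∘ b Y = idm _ by rewrite /b'; case: cid => ? [].
have bb' Y : b Y ∘ b' Y = idm _ by rewrite /b'; case: cid => ? [].
pose lift X Y s := projT1 (cid (full X Y s)).
have liftE X Y s : fmor S (lift X Y s) = s by rewrite /lift; case: cid.
pose gm X Y (f : hom X Y) := lift _ _ (b' Y ∘ f ∘ b X).
have gm1 X : gm X X (idm X) = idm (g X).
  by apply: faith; rewrite liftE compm1 b'b fmor_id.
have gmM X Y Z (f : hom Y Z) (e : hom X Y) : gm X Z (f ∘ e) = gm Y Z f ∘ gm X Y e.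
  apply: faith; rewrite fmor_comp !liftE !compA; congr (_ ∘ _ ∘ _).
  by rewrite -!compA bb' compm1.
exists (Functor gm1 gmM), (fun X => lift _ _ (b' (S X))), b; split=> //=.
- move=> X; exists (lift _ _ (b (S X))).
  by split; apply: faith; rewrite fmor_comp !liftE fmor_id.
- move=> X Y f; apply: faith; rewrite !fmor_comp !liftE.
  by rewrite -compA bb' compm1.
- by move=> X Y f; rewrite liftE !compA bb' comp1m.
Qed.

Section Serre.
Variables (k : fieldType) (C : klinCat k).

(** The first hypothesis gives the functor: [S u] is the morphism that represents
    the form [m |-> phi (m ∘ u)].  Nondegeneracy on the two sides gives
    uniqueness of [S u], hence functoriality, and full faithfulness.  The second
    hypothesis, with [pair_unique], gives essential surjectivity. *)
Lemma pairs_serre :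
  (forall X : C, exists Z, serre_paired X Z) ->
  (forall Z : C, exists X, serre_paired X Z) -> has_serre C.
Proof.
move=> HX HZ; have [S HS] := choice HX.
pose phi X := projT1 (cid (HS X)).
pose P X : serre_pair (phi X) := projT2 (cid (HS X)).
have phiP X a f g : phi X (a *: f + g) = a *: phi X f + phi X g by exact: linearP.
have H X Y (u : hom X Y) : exists s : hom (S X) (S Y),
    forall m, phi X (m ∘ u) = phi Y (s ∘ m).
  by apply: (pair_repr (P Y)); apply: linear_compl.
pose Sm X Y u := projT1 (cid (H X Y u)).
have SmE X Y u m : phi X (m ∘ u) = phi Y (Sm X Y u ∘ m).
  by rewrite /Sm; case: cid.
have Sm1 X : Sm X X (idm X) = idm (S X).
  by apply: (pair_ext_l (P X)) => m; rewrite -SmE compm1 comp1m.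
have SmM X Y Z (f : hom Y Z) (e : hom X Y) : Sm X Z (f ∘ e) = Sm Y Z f ∘ Sm X Y e.
  by apply: (pair_ext_l (P Z)) => m; rewrite -SmE -compA -SmE compA SmE compA.
have Sm_lin X Y : linear (Sm X Y).
  move=> a u v; apply: (pair_ext_l (P Y)) => m.
  rewrite -SmE (comp_linear_l m) [RHS]phiP -!SmE.
  by rewrite comp_linear_r phiP.
pose SF := Functor Sm1 SmM.
have eta_ex X Y (f : hom X Y) := linear_lfun (linear_compl (phi X) f).
pose eta X Y f := projT1 (cid (eta_ex X Y f)).
have etaE X Y f g : eta X Y f g = phi X (g ∘ f).
  by rewrite /eta; case: cid => F /= ->.
exists SF; split.
- exact: Sm_lin.
- apply: full_faithful_equivalence => /=.
  + move=> X Y s; have [u uE] := pair_corepr (P X) (linear_compr (phi Y) s).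
    by exists u; apply: (pair_ext_l (P Y)) => m; rewrite -SmE uE.
  + move=> X Y u v e; apply: (pair_ext_r (P X)) => m.
    by rewrite SmE e -SmE.
  + by move=> Z; have [X XZ] := HZ Z; exists X; apply: pair_unique XZ; apply: HS.
exists eta; split.
- move=> X Y a u v; apply/lfunP => m; rewrite add_lfunE scale_lfunE !etaE.
  by rewrite comp_linear_r linearP.
- move=> X Y; have inv (psi : 'Hom(hom Y (S X), k^o)) : exists f, eta X Y f = psi.
    have [f fE] := pair_corepr (P X) (psi := psi) (linearP _).
    by exists f; apply/lfunP => m; rewrite etaE fE.
  have [einv einvE] := choice inv.
  exists einv => // f; apply: (pair_ext_r (P X)) => m.
  by rewrite -!etaE einvE.
- by move=> X X' Y Y' u v f g; rewrite !etaE /= -!compA -SmE !compA.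
Qed.

(** By naturality the isomorphism [eta X Y] is determined by the single form
    [eta X X (idm X)] on Hom(X, S X). *)
Lemma serre_serre_paired (S : functor C) : is_serre S -> forall X, serre_paired X (S X).
Proof.
move=> [_ _ [eta [elin ebij enat]]] X; exists (eta X X (idm X)).
have etaE Y (f : hom X Y) g : eta X X (idm X) (g ∘ f) = eta X Y f g.
  by have := enat _ _ _ _ (idm X) f (idm X) g; rewrite fmor_id comp1m !compm1.
split=> Y f H.
  apply: (bij_inj (ebij X Y)); apply/lfunP => g; rewrite -etaE H.
  have e0 : eta X Y 0 = 0.
    by have := elin X Y 1 0 0; rewrite !scale1r addr0 -[LHS]addr0 => /addrI.
  by rewrite e0 lfunE.
apply/eqP; apply: contrapT => /negP /dual_nonzero[psi psi1].
have [einv _ eK] := ebij X Y; have := H (einv psi).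
by rewrite etaE eK psi1 => /eqP; rewrite oner_eq0.
Qed.

Lemma serre_surj (S : functor C) : is_serre S -> forall Z : C, exists X, serre_paired X Z.
Proof.
move=> SS Z; have [_ [G [_ [b [_ bi _ _]]]] _] := SS.
exists (G Z); apply: pair_iso (serre_serre_paired SS (G Z)) _.
by exists (b Z).
Qed.

End Serre.

(** * Equalities of arrows *)

Section Arrows.
Variables (k : fieldType) (C : klinCat k).
Implicit Types X Y Z : C.

Lemma arr_inj X Y (f g : hom X Y) : arr f = arr g -> f = g.
Proof.
move=> e; have := projT2_eq e.
by rewrite (Prop_irrelevance (projT1_eq e) erefl).
Qed.

Lemma arr_source X Y X' Y' (f : hom X Y) (g : hom X' Y') : arr f = arr g -> X = X'.
Proof. by move=> /(congr1 (fun a => (projT1 a).1)). Qed.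

Lemma arr_target X Y X' Y' (f : hom X Y) (g : hom X' Y') : arr f = arr g -> Y = Y'.
Proof. by move=> /(congr1 (fun a => (projT1 a).2)). Qed.

(** The identity morphism seen along an equality of objects, with which equalities
    between arrows become commutative squares. *)
Definition eqm X Y (e : X = Y) : hom X Y :=
  match e in _ = Y' return hom X Y' with erefl => idm X end.

Lemma eqm_iso X Y (e : X = Y) : is_iso (eqm e).
Proof. by case: _ / e; apply: iso_id. Qed.

Lemma arr_eqm X Y X' Y' (f : hom X Y) (g : hom X' Y') (eX : X = X') (eY : Y = Y') :
  arr f = arr g -> eqm eY ∘ f = g ∘ eqm eX.
Proof.
by case: _ / eX g; case: _ / eY => g /= /arr_inj ->; rewrite comp1m compm1.
Qed.

Lemma recast X Y X' Y' (f : hom X Y) : X' = X -> Y' = Y ->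
  exists g : hom X' Y', arr g = arr f.
Proof. by move=> -> ->; exists f. Qed.

Variable (F : functor C).

Lemma arr_fmor X Y X' Y' (f : hom X Y) (g : hom X' Y') :
  arr f = arr g -> arr (fmor F f) = arr (fmor F g).
Proof.
by move=> /(congr1 (fun a : arrow C => arr (fmor F (projT2 a)))).
Qed.

Lemma eqm_fmor X Y (e : X = Y) (e' : F X = F Y) : eqm e' = fmor F (eqm e).
Proof.
by case: _ / e e' => e'; rewrite (Prop_irrelevance e' erefl) /= fmor_id.
Qed.

Lemma fmor_iso X Y (f : hom X Y) : is_iso f -> is_iso (fmor F f).
Proof. by move=> [g [gf fg]]; exists (fmor F g); rewrite -!fmor_comp gf fg !fmor_id. Qed.

End Arrows.

(** * The suspension functor *)

Section Automorphism.
Variables (k : fieldType) (C : klinCat k) (Sigma : automorphism C).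
Implicit Types X Y Z : C.

Lemma ainv_obj X : Sigma (ainv Sigma X) = X.
Proof. exact: arr_source (ainvK Sigma (idm X)). Qed.

Lemma aut_faithful X Y (f g : hom X Y) : fmor Sigma f = fmor Sigma g -> f = g.
Proof. by move=> e; apply: arr_inj; rewrite -(afunK Sigma f) e afunK. Qed.

Lemma aut_full X Y (g : hom (Sigma X) (Sigma Y)) : exists f : hom X Y, fmor Sigma f = g.
Proof.
have obj Z : Z = ainv Sigma (Sigma Z) by exact/esym/(arr_source (afunK Sigma (idm Z))).
have [f fE] := recast (fmor (ainv Sigma) g) (obj X) (obj Y).
by exists f; apply: arr_inj; rewrite (arr_fmor Sigma fE) ainvK.
Qed.

Lemma aut0 X Y : fmor Sigma (0 : hom X Y) = 0.
Proof. by apply: (addrI (fmor Sigma 0)); rewrite -afunD !addr0. Qed.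

Lemma autN X Y (f : hom X Y) : fmor Sigma (- f) = - fmor Sigma f.
Proof. by apply: (addrI (fmor Sigma f)); rewrite -afunD !subrr aut0. Qed.

Lemma aut_sign X Y (f : hom X Y) d :
  fmor Sigma ((-1) ^+ d *: f) = (-1) ^+ d *: fmor Sigma f.
Proof.
by rewrite -signr_odd; case: (odd d); rewrite ?scaleN1r ?scale1r ?autN.
Qed.

Lemma aut_eq0 X Y (f : hom X Y) : fmor Sigma f = 0 -> f = 0.
Proof. by rewrite -(aut0 X Y); apply: aut_faithful. Qed.

Lemma aut_iso X Y (f : hom X Y) : is_iso (fmor Sigma f) -> is_iso f.
Proof.
move=> [g' [e1 e2]]; have [g gE] := aut_full g'; exists g.
by split; apply: aut_faithful; rewrite fmor_comp gE ?e1 ?e2 fmor_id.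
Qed.

Lemma aut_isomorphic X Y : isomorphic (Sigma X) (Sigma Y) -> isomorphic X Y.
Proof.
by move=> [f fi]; have [g gE] := aut_full f; exists g; apply: aut_iso; rewrite gE.
Qed.

Lemma ainv_isomorphic X : isomorphic (Sigma (ainv Sigma X)) X.
Proof. by exists (eqm (ainv_obj X)); apply: eqm_iso. Qed.

Lemma aut_local X : local_end (Sigma X) <-> local_end X.
Proof.
split=> -[id0 loc]; split.
- by move=> e; apply: id0; rewrite -fmor_id e aut0.
- move=> f g /(fmor_iso Sigma); rewrite afunD => /loc[]/aut_iso; tauto.
- by move=> e; apply: id0; apply: aut_eq0; rewrite fmor_id.
move=> f g; have [f' <-] := aut_full f; have [g' <-] := aut_full g.
by rewrite -afunD => /aut_iso/loc[]/(fmor_iso Sigma); tauto.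
Qed.

(** Divisibility between morphisms is reflected by a full and faithful functor. *)
Lemma aut_linking X Z (h : hom X Z) : linking (fmor Sigma h) -> linking h.
Proof.
move=> [h0 hl hr]; split.
- by move=> e; apply: h0; rewrite e aut0.
- move=> Y g g0; have [|f' fE] := hl _ (fmor Sigma g); first by move/aut_eq0.
  have [f e] := aut_full f'; exists f; apply: aut_faithful.
  by rewrite fmor_comp e.
- move=> Y f f0; have [|g' gE] := hr _ (fmor Sigma f); first by move/aut_eq0.
  have [g e] := aut_full g'; exists g; apply: aut_faithful.
  by rewrite fmor_comp e.
Qed.

End Automorphism.

(** * Rotations *)

Section Rotation.
Variables (k : fieldType) (C : klinCat k) (Sigma : automorphism C) (d : nat).

(** Shifting a family to the right this way keeps [cons_term X T i.+1] convertible
    to [T i], so a rotated sequence has the original maps without transport. *)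
Definition cons_term (X : C) (T : nat -> C) (i : nat) : C :=
  if i is j.+1 then T j else X.

Definition cons_mor (X : C) (T : nat -> C) (m0 : hom X (T 0%N))
    (m : forall i, hom (T i) (T i.+1)) (i : nat) :
    hom (cons_term X T i) (cons_term X T i.+1) :=
  match i with 0%N => m0 | j.+1 => m j end.

(** The new first map is the desuspension of the connecting morphism up to the sign
    [(-1) ^+ d], which squares to 1. *)
Lemma unrotation (A : dseq Sigma d) :
  exists (X : C) (m0 : hom X (A 0%N)) (c : hom (A d) (Sigma X))
         (u : hom (Sigma X) (A d.+1)),
    [/\ is_iso u,
        is_left_rotation (@DSeq _ C Sigma d (cons_term X A) (cons_mor m0 (@mor _ _ _ _ A)) c) A,
        u ∘ c = mor A d & conn A ∘ u = (-1) ^+ d *: fmor Sigma m0].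
Proof.
pose X := ainv Sigma (A d.+1).
have eX : Sigma X = A d.+1 by exact: ainv_obj.
have [c cE] := recast (mor A d) erefl eX.
have [n nE] := recast (conn A) eX erefl.
have [m mE] := aut_full n.
have nE' : (-1) ^+ d *: fmor Sigma ((-1) ^+ d *: m) = n.
  by rewrite aut_sign scalerA -expr2 sqrr_sign scale1r mE.
exists X, ((-1) ^+ d *: m), c, (eqm eX); split.
- exact: eqm_iso.
- by split=> //=; rewrite nE'.
- by rewrite (arr_eqm erefl eX cE) compm1.
- by rewrite -(arr_eqm eX erefl nE) comp1m nE'.
Qed.

Lemma left_rotation (A : dseq Sigma d) : exists B : dseq Sigma d, is_left_rotation A B.
Proof.
pose T i := if i == d.+1 then Sigma (A 0%N) else A i.+1.
have TE i : (i <= d)%N -> T i = A i.+1.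
  by rewrite /T; case: eqP => // ->; rewrite ltnn.
have Td : T d.+1 = Sigma (A 0%N) by rewrite /T eqxx.
have mP i : exists m : hom (T i) (T i.+1),
    ((i < d)%N -> arr m = arr (mor A i.+1)) /\ (i = d -> arr m = arr (conn A)).
  have [lt|gt|->] := ltngtP i d.
  - have [m mE] := recast (mor A i.+1) (TE _ (ltnW lt)) (TE _ lt).
    by exists m; split=> // e; rewrite e ltnn in lt.
  - by exists 0; split=> // e; rewrite e ltnn in gt.
  - by have [m mE] := recast (conn A) (TE d (leqnn d)) Td; exists m.
have [c cE] := recast ((-1) ^+ d *: fmor Sigma (mor A 0%N)) Td (congr1 Sigma (TE _ (leq0n d))).
exists (@DSeq _ C Sigma d T (fun i => projT1 (cid (mP i))) c).
split=> /= [i lt||//]; case: cid => m /= [mE mE'].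
  exact: mE.
exact: mE'.
Qed.

(** The equalities of arrows in [is_left_rotation] are traded for isomorphisms
    [psi] with commutative squares. *)
Lemma left_rotation_iso (A B : dseq Sigma d) : is_left_rotation A B ->
  exists (psi : forall i, hom (A i.+1) (B i)) (psi' : hom (Sigma (A 0%N)) (B d.+1)),
    [/\ (forall i, (i <= d)%N -> is_iso (psi i)) /\ is_iso psi',
        forall i, (i < d)%N -> mor B i ∘ psi i = psi i.+1 ∘ mor A i.+1,
        mor B d ∘ psi d = psi' ∘ conn A
      & conn B ∘ psi' = fmor Sigma (psi 0%N) ∘ ((-1) ^+ d *: fmor Sigma (mor A 0%N))].
Proof.
move=> [R1 R2 R3].
have e i : (i <= d)%N -> A i.+1 = B i.
  rewrite leq_eqVlt => /orP[/eqP ->|lt]; first by have := arr_source R2.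
  by have := arr_source (R1 _ lt).
have e' : Sigma (A 0%N) = B d.+1 by have := arr_target R2.
have psiP i : exists p : hom (A i.+1) (B i), forall le : (i <= d)%N, p = eqm (e i le).
  have [le|gt] := pselect (i <= d)%N; last by exists 0.
  by exists (eqm (e i le)) => le'; rewrite (Prop_irrelevance le le').
pose psi i := projT1 (cid (psiP i)).
have psiE i le : psi i = eqm (e i le) by rewrite /psi; case: cid.
exists psi, (eqm e'); split.
- by split=> [i le|]; [rewrite psiE|]; apply: eqm_iso.
- move=> i lt; rewrite (psiE i (ltnW lt)) (psiE i.+1 lt).
  by apply/esym/arr_eqm/esym/R1.
- by rewrite (psiE _ (leqnn d)); apply/esym/arr_eqm/esym/R2.
- rewrite (psiE _ (leq0n d)) -(eqm_fmor (e 0%N (leq0n d)) (congr1 Sigma (e 0%N (leq0n d)))).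
  by apply/esym/arr_eqm/esym/R3.
Qed.

End Rotation.

(** * Exactness of angles *)

Lemma sign_comp0 (k : fieldType) (V : vectType k) (x : V) d :
  (-1) ^+ d *: x = 0 -> x = 0.
Proof.
by move/(congr1 ( *:%R ((-1) ^+ d))); rewrite scalerA -expr2
  sqrr_sign scale1r scaler0.
Qed.

Section Angles.
Variables (k : fieldType) (C : klinCat k) (Sigma : automorphism C) (d : nat).
Variable (Theta : dseq Sigma d -> Prop).
Hypotheses (hd : (1 <= d)%N) (Cadd : additive_cat C) (Cang : angulated Theta).
Implicit Types (X Y Z M : C) (A B : dseq Sigma d).

(** The angle [M -> M -> 0 -> ... -> 0], with [Z] a zero object. *)
Definition trivial_dseq M Z : dseq Sigma d :=
  @DSeq _ C Sigma d (cons_term M (cons_term M (fun=> Z)))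
    (@cons_mor _ C M (cons_term M (fun=> Z)) (idm M)
       (@cons_mor _ C M (fun=> Z) 0 (fun=> 0))) 0.

Lemma trivial_angle M Z : is_zero Z -> Theta (trivial_dseq M Z).
Proof.
move=> Zz; have [[_ _ H _] _ _ _] := Cang; apply: (H M) => //.
by move=> [|[|i]].
Qed.

(** Extend the square given by [idm] and [mor A 0] from the trivial angle to [A]:
    the composite factors through the zero object in position 2. *)
Lemma angle_complex A : Theta A -> mor A 1 ∘ mor A 0%N = 0.
Proof.
move=> TA; have [Z Zz] := proj1 Cadd; have [_ _ N3 _] := Cang.
have [|phi [e0 e1 [/(_ 1%N hd) sq _]]] :=
  N3 (trivial_dseq (A 0%N) Z) A (idm _) (mor A 0%N) (trivial_angle _ Zz) TA.
  by [].
by have := sq; rewrite e1 /= comp0r => <-.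
Qed.

Lemma angle_unrotation A : Theta A ->
  exists (X : C) (m0 : hom X (A 0%N)) (c : hom (A d) (Sigma X))
         (u : hom (Sigma X) (A d.+1)),
    [/\ is_iso u,
        Theta (@DSeq _ C Sigma d (cons_term X A) (cons_mor m0 (@mor _ _ _ _ A)) c),
        u ∘ c = mor A d & conn A ∘ u = (-1) ^+ d *: fmor Sigma m0].
Proof.
move=> TA; have [X [m0 [c [u [ui R uc cu]]]]] := unrotation A.
by have [_ /(_ _ _ R)/iffRL/(_ TA) TL _ _] := Cang; exists X, m0, c, u.
Qed.

Lemma angle_left_rotation A : Theta A -> exists B, Theta B /\ is_left_rotation A B.
Proof.
move=> TA; have [B R] := left_rotation A; exists B; split=> //.
by have [_ /(_ _ _ R)/iffLR/(_ TA) TB _ _] := Cang.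
Qed.

(** Rotating to the left moves every pair of consecutive maps to position 0. *)
Lemma angle_complex_all A i : Theta A -> (i < d)%N -> mor A i.+1 ∘ mor A i = 0.
Proof.
elim: i A => [|i IH] A TA lt; first exact: angle_complex.
have [B [TB /left_rotation_iso[psi [_ [[psii _] sq _ _]]]]] := angle_left_rotation TA.
have lt' := ltnW lt.
apply: (iso_cancel_l (psii _ lt)).
by rewrite compA -sq // -compA -sq // compA IH // comp0l comp0r.
Qed.

Lemma angle_complex_Sigma A : Theta A -> fmor Sigma (mor A 0%N) ∘ conn A = 0.
Proof.
move=> TA; have [X [m0 [c [u [ui TL uc cu]]]]] := angle_unrotation TA.
have /= e := angle_complex TL.
apply: (iso_cancel_r ui); rewrite -compA cu compZr -fmor_comp e aut0 scaler0.
by rewrite comp0l.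
Qed.

Lemma angle_complex_conn A : Theta A -> conn A ∘ mor A d = 0.
Proof.
move=> TA; have [X [m0 [c [u [ui TL uc cu]]]]] := angle_unrotation TA.
have /= e := angle_complex_Sigma TL.
by rewrite -uc compA cu compZl e scaler0.
Qed.

(** Extend the square given by [0] and [x] from [A] to the unrotated trivial angle
    [_ -> M -> M -> 0 -> ...], whose second map is an identity. *)
Lemma angle_weak_coker A M (x : hom (A 1%N) M) : Theta A -> x ∘ mor A 0%N = 0 ->
  exists y : hom (A 2%N) M, x = y ∘ mor A 1%N.
Proof.
move=> TA e; have [Z Zz] := proj1 Cadd; have [_ _ N3 _] := Cang.
have [X [m0 [c [u [ui TL uc cu]]]]] := angle_unrotation (trivial_angle M Zz).
have [|phi [e0 e1 [/(_ 1%N hd) /= sq _]]] :=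
  N3 A (DSeq (cons_mor m0 (@mor _ _ _ _ (trivial_dseq M Z))) c) 0 x TA TL.
  by rewrite comp0r.
by exists (phi 2%N); rewrite -[LHS]comp1m -e1 -sq.
Qed.

(** Extend the square given by [x] and [0] from the rotated trivial angle
    [M -> 0 -> ... -> Sigma M] to [A], and read the factorization off the last
    square, where the connecting morphism of the source is an isomorphism. *)
Lemma angle_weak_ker A M (x : hom M (A 0%N)) : Theta A -> mor A 0%N ∘ x = 0 ->
  exists y : hom (Sigma M) (A d.+1), fmor Sigma x = conn A ∘ y.
Proof.
move=> TA e; have [Z Zz] := proj1 Cadd; have [_ _ N3 _] := Cang.
have [B [TB /left_rotation_iso[psi [psi' [[psii psi'i] sq sqd c]]]]] :=
  angle_left_rotation (trivial_angle M Zz).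
have [v [vl vr]] := psii 0%N (leq0n d).
have B1z (f : hom (B 1%N) (A 1%N)) : f = 0.
  have [w [wl wr]] := psii 1%N hd; rewrite -(compm1 f) -wr compA.
  by rewrite (proj2 Zz _ (f ∘ _)) comp0l.
have [|phi [e0 e1 [_ sqc]]] := N3 _ _ (x ∘ v) 0 TB TA.
  by rewrite comp0l compA e comp0l.
have := c; rewrite /= fmor_id => /(congr1 (fun t => fmor Sigma (x ∘ v) ∘ t)).
rewrite !compA -e0 sqc compZr compm1 -fmor_comp e0 -(compA x) vl compm1 => E.
exists ((-1) ^+ d *: (phi d.+1 ∘ psi')).
by rewrite compZr compA E scalerA -expr2 sqrr_sign scale1r.
Qed.

(** [angle_weak_ker] for the unrotated angle, whose first map is a desuspension of
    [conn A] and whose connecting morphism is [mor A d]. *)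
Lemma angle_conn_ker A M (x : hom M (A d.+1)) : Theta A -> conn A ∘ x = 0 ->
  exists y, x = mor A d ∘ y.
Proof.
move=> TA e; have [X [m0 [c [u [ui TL uc cu]]]]] := angle_unrotation TA.
have [u' [u'i u'u uu']] := iso_inv ui.
have [N [r [r' [r'r rr']]]] : exists N, isomorphic (Sigma N) M.
  by exists (ainv Sigma M); apply: ainv_isomorphic.
have [n nE] := aut_full (u' ∘ x ∘ r).
have [|y yE] := 
  angle_weak_ker (A := DSeq (cons_mor m0 (@mor _ _ _ _ A)) c) (x := n) TL.
  apply: (@aut_eq0 _ _ Sigma); rewrite fmor_comp nE /=.
  apply: (@sign_comp0 _ _ _ d); rewrite -compZl -cu -!compA (compA u) uu' comp1m.
  by rewrite compA e comp0l.
exists (y ∘ r'); rewrite compA -uc -(compA u) -[c ∘ y]yE nE !compA uu' comp1m.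
by rewrite -compA rr' compm1.
Qed.

(** [angle_weak_coker] for the unrotated angle. *)
Lemma angle_conn_coker A M (x : hom (A 0%N) M) : Theta A ->
  fmor Sigma x ∘ conn A = 0 -> exists y, x = y ∘ mor A 0%N.
Proof.
move=> TA e; have [X [m0 [c [u [ui TL uc cu]]]]] := angle_unrotation TA.
apply: (angle_weak_coker (A := DSeq (cons_mor m0 (@mor _ _ _ _ A)) c) TL) => /=.
apply: (@aut_eq0 _ _ Sigma); apply: (@sign_comp0 _ _ _ d).
by rewrite fmor_comp -compZr -cu compA e comp0l.
Qed.

(** Rotate to the left an angle on the desuspension of [h], with the sign of the
    rotation put in beforehand. *)
Lemma angle_with_conn X Z (h : hom X Z) :
  exists A (u : hom (A d.+1) X) (v : hom (Sigma (A 0%N)) Z),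
    [/\ Theta A, is_iso u, is_iso v & v ∘ conn A = h ∘ u].
Proof.
have [r ri] := ainv_isomorphic Sigma X; have [s si] := ainv_isomorphic Sigma Z.
have [s' [s'i s's ss']] := iso_inv si.
have [n nE] := aut_full (s' ∘ h ∘ r).
have [[_ _ _ /(_ _ _ ((-1) ^+ d *: n))[K [TK Kn]]] _ _ _] := Cang.
have [B [TB /left_rotation_iso[psi [psi' [[psii psi'i] sq sqd c]]]]] := angle_left_rotation TK.
have e0 := arr_source Kn; have e1 := arr_target Kn.
have Kn' := arr_eqm e0 e1 Kn.
have [p [pi psi'p ppsi']] := iso_inv psi'i.
have [q [qi psi0q qpsi0]] := iso_inv (fmor_iso Sigma (psii 0%N (leq0n d))).
exists B, (r ∘ fmor Sigma (eqm e0) ∘ p), (s ∘ fmor Sigma (eqm e1) ∘ q); split=> //.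
- by do !apply: iso_comp => //; apply/fmor_iso/eqm_iso.
- by do !apply: iso_comp => //; apply/fmor_iso/eqm_iso.
apply: (iso_cancel_r psi'i); rewrite -!compA c psi'p compm1.
rewrite (compA q) psi0q comp1m compZr -fmor_comp Kn' fmor_comp aut_sign compZl compZr.
by rewrite compZr scalerA -expr2 sqrr_sign scale1r nE !compA ss' comp1m.
Qed.

End Angles.

(** * Connecting morphisms and almost split morphisms *)

Section AlmostSplit.
Variables (k : fieldType) (C : klinCat k) (Sigma : automorphism C) (d : nat).
Variable (Theta : dseq Sigma d -> Prop).
Hypotheses (hd : (1 <= d)%N) (Cadd : additive_cat C) (Cang : angulated Theta).
Implicit Types (X Y Z M : C) (A B : dseq Sigma d).

(** Complete [g] to an angle; [w] is the map that precedes [g] in it. *)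
Lemma mor_weak_coker X Y (g : hom X Y) : exists (W : C) (w : hom W X),
  g ∘ w = 0 /\ forall M (x : hom X M), x ∘ w = 0 -> exists y, x = y ∘ g.
Proof.
have [[_ _ _ /(_ _ _ g)[K [TK Kg]]] _ _ _] := Cang.
have [X0 [m0 [c [u [ui TL uc cu]]]]] := angle_unrotation Cang TK.
have e0 := arr_source Kg; have e1 := arr_target Kg.
have sq := arr_eqm e0 e1 Kg.
have [r [_ r'r rr']] := iso_inv (eqm_iso e0).
exists X0, (eqm e0 ∘ m0); split.
  rewrite compA -sq -compA; have /= -> := angle_complex hd Cadd Cang TL.
  by rewrite comp0r.
move=> M x e; have [|y yE] := angle_weak_coker hd Cadd Cang
    (A := DSeq (cons_mor m0 (@mor _ _ _ _ K)) c) (x := x ∘ eqm e0) TL.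
  by rewrite -compA.
have [v [_ v'v vv']] := iso_inv (eqm_iso e1).
exists (y ∘ v); rewrite /= in yE; apply: (iso_cancel_r (eqm_iso e0)).
by rewrite yE -compA -sq (compA _ _ (mor K 0)) -(compA y) v'v compm1.
Qed.

(** Complete [f] to an angle in which it is the connecting morphism; by
    exactness at [Sigma Z], it is a weak kernel of the map that follows it, which
    is up to sign the suspension of the first map of the angle. *)
Lemma mor_weak_ker Y Z (f : hom Y (Sigma Z)) : exists (V : C) (v : hom Z V),
  fmor Sigma v ∘ f = 0 /\
  forall M (x : hom M (Sigma Z)), fmor Sigma v ∘ x = 0 -> exists y, x = f ∘ y.
Proof.
have [K [u [v' [TK ui v'i sq]]]] := angle_with_conn Cang f.
have [v vE] := aut_full v'.
have vi : is_iso v by apply: (@aut_iso _ _ Sigma); rewrite vE.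
have [t [ti tv vt]] := iso_inv vi.
exists (K 1%N), (mor K 0%N ∘ t); split.
  apply: (iso_cancel_r ui); rewrite -compA -sq -vE fmor_comp compACA -fmor_comp tv.
  by rewrite fmor_id compm1 (angle_complex_Sigma hd Cadd Cang) // comp0l.
move=> M x e; have [N [r ri]] : exists N, isomorphic (Sigma N) M.
  by exists (ainv Sigma M); apply: ainv_isomorphic.
have [r' [_ r'r rr']] := iso_inv ri.
have [n nE] := aut_full (fmor Sigma t ∘ x ∘ r).
have [|y yE] := angle_weak_ker hd Cadd Cang (x := n) TK.
  apply: (@aut_eq0 _ _ Sigma).
  by rewrite fmor_comp nE !compA -fmor_comp e comp0l.
exists (u ∘ y ∘ r'); rewrite !compA -sq -(compA v') -yE nE.
by rewrite -vE !compA -fmor_comp vt fmor_id comp1m -compA rr' compm1.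
Qed.

(** A nonzero [g] is a weak cokernel of some [w], which is not a split epimorphism
    since [g ∘ w = 0].  So [w] factors through the right almost split [mor A d]
    and is killed by [conn A], and therefore [g] divides [conn A].  The other divisibility
    is obtained in the same way from the left almost split [mor A 0]. *)
Lemma AR_linking A : AR_angle Theta A -> linking (conn A).
Proof.
move=> [TA [nsm las] [nse ras] _]; split.
- move=> e; have [|y yE] := angle_conn_ker hd Cadd Cang (x := idm _) TA.
    by rewrite e comp0l.
  by apply: nse; exists y.
- move=> Y g g0; have [W [w [gw wk]]] := mor_weak_coker g.
  have [|y yE] := ras _ w.
    by move=> [s ws]; apply: g0; rewrite -(compm1 g) -ws compA gw comp0l.
  have [|f fE] := wk _ (conn A); last by exists f.
  by rewrite -yE compA (angle_complex_conn hd Cadd Cang) // comp0l.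
move=> Y f f0; have [V [v [vf wc]]] := mor_weak_ker f.
have [|y yE] := las _ v.
  move=> [s sv]; apply: f0; rewrite -(comp1m f) -fmor_id -sv fmor_comp.
  by rewrite -compA vf comp0r.
have [|g gE] := wc _ (conn A); last by exists g.
by rewrite -yE fmor_comp -compA
    (angle_complex_Sigma hd Cadd Cang) // comp0r.
Qed.

(** By exactness at the end terms, a morphism into [A d.+1] factors through
    [mor A d] once [conn A] kills it, and a morphism out of [A 0] factors
    through [mor A 0] once its suspension kills [conn A]. *)
Lemma socle_almost_split A : Theta A -> socle_map (conn A) ->
  left_almost_split (mor A 0%N) /\ right_almost_split (mor A d).
Proof.
move=> TA [h0 hl hr]; split; split.
- move=> [s sE]; apply: h0.
  by rewrite -(comp1m (conn A)) -fmor_id -sE fmor_comp -compA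
    (angle_complex_Sigma hd Cadd Cang) // comp0r.
- move=> M g ng; have [|y ->] := angle_conn_coker hd Cadd Cang (x := g) TA; last by exists y.
  apply: hr => -[s' sE]; apply: ng; have [s e] := aut_full s'; exists s.
  by apply: (@aut_faithful _ _ Sigma); rewrite fmor_comp e fmor_id.
- move=> [s sE]; apply: h0.
  by rewrite -(compm1 (conn A)) -sE compA (angle_complex_conn hd Cadd Cang) // comp0l.
- move=> M g ng; have [|y ->] := angle_conn_ker hd Cadd Cang (x := g) TA; last by exists y.
  exact: hl.
Qed.

Section Retract.
Variables (A B : dseq Sigma d) (w : forall i, hom (B i) (A i)) (q : forall i, hom (A i) (B i)).
Hypotheses (wm : is_dseq_mor w) (qm : is_dseq_mor q).
Hypothesis (qw : forall i, (i <= d.+1)%N -> q i ∘ w i = idm (B i)).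

Lemma retract_mor i : (i <= d)%N -> mor B i = q i.+1 ∘ mor A i ∘ w i.
Proof. by move=> le; rewrite (proj1 qm) // -compA qw ?compm1 // ltnW. Qed.

Lemma retract_las : w 0%N ∘ q 0%N = idm _ ->
  left_almost_split (mor A 0%N) -> left_almost_split (mor B 0%N).
Proof.
move=> wq [ns las]; split.
  move=> [s sE]; apply: ns; exists (w 0%N ∘ s ∘ q 1%N).
  by rewrite -compA (proj1 qm) // -compA (compA s) sE comp1m wq.
move=> M g ng; have [|y yE] := las _ (g ∘ q 0%N).
  move=> [s sE]; apply: ng; exists (q 0%N ∘ s).
  have -> : q 0%N ∘ s ∘ g = q 0%N ∘ (s ∘ (g ∘ q 0%N)) ∘ w 0%N.
    by rewrite !compA -(compA _ _ (w 0%N)) qw // compm1.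
  by rewrite sE compm1 qw.
exists (y ∘ w 1%N); rewrite -compA (proj1 wm) // compA yE -compA qw //.
by rewrite compm1.
Qed.

Lemma retract_ras : w d.+1 ∘ q d.+1 = idm _ ->
  right_almost_split (mor A d) -> right_almost_split (mor B d).
Proof.
move=> wq [ns ras]; split.
  move=> [s sE]; apply: ns; exists (w d ∘ s ∘ q d.+1).
  by rewrite !compA -(proj1 wm) // -(compA _ _ s) sE compm1 wq.
move=> M g ng; have [|y yE] := ras _ (w d.+1 ∘ g).
  move=> [s sE]; apply: ng; exists (s ∘ w d.+1).
  have -> : g ∘ (s ∘ w d.+1) = q d.+1 ∘ (w d.+1 ∘ g ∘ s) ∘ w d.+1.
    by rewrite !compA qw // comp1m.
  by rewrite sE compm1 qw.
exists (q d ∘ y); rewrite compA -(proj1 qm) // -compA yE compA qw //.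
by rewrite comp1m.
Qed.

Lemma retract_AR : w 0%N ∘ q 0%N = idm _ -> w d.+1 ∘ q d.+1 = idm _ ->
  Theta B -> AR_angle Theta A -> AR_angle Theta B.
Proof.
move=> e0 e1 TB [_ las ras rad]; split=> //; [exact: retract_las | exact: retract_ras |].
move=> i /andP[i1 id]; rewrite retract_mor 1?ltnW //.
by apply/in_rad_compr/in_rad_compl/rad; rewrite i1.
Qed.

End Retract.

End AlmostSplit.

(** * Removing trivial direct summands *)

Record split_idem (k : fieldType) (C : klinCat k) (X : C) (e : hom X X) := SplitIdem {
  im : C; co : C;
  im_in : hom im X; im_out : hom X im; co_in : hom co X; co_out : hom X co;
  im_outK : im_out ∘ im_in = idm im;
  co_outK : co_out ∘ co_in = idm co;
  im_co : im_out ∘ co_in = 0;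
  co_im : co_out ∘ im_in = 0;
  im_idem : im_in ∘ im_out = e;
  co_idem : co_in ∘ co_out = idm X - e
}.

(** Conjugation embeds End(W) into End(X); the identity of [X] is in the image only
    if the retract is all of [X].  This is the measure that decreases in
    [reduce_angle]. *)
Lemma dim_end_retract (k : fieldType) (C : klinCat k) (X W : C)
    (w : hom W X) (q : hom X W) : q ∘ w = idm W ->
  (dim (hom W W) <= dim (hom X X))%N /\
  (w ∘ q <> idm X -> (dim (hom W W) < dim (hom X X))%N).
Proof.
move=> qw; pose f (x : hom W W) : hom X X := w ∘ x ∘ q.
have [|F FE] := @linear_lfun _ _ _ f.
  by move=> a u v; rewrite /f comp_linear_r (comp_linear_l q).
have Fi : injective F.
  move=> x y; rewrite !FE /f => /(congr1 (fun t => q ∘ t ∘ w)).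
  by rewrite -!compA qw !compA qw !compm1 !comp1m.
split; first exact: inj_dim_le Fi.
move=> wq; rewrite ltnNge; apply/negP => le; apply: wq.
have [x] := inj_dim_surj Fi le (idm X); rewrite FE /f => E.
by rewrite -[LHS]compm1 -E -!compA (compA q) qw comp1m.
Qed.

Section Reduce.
Variables (k : fieldType) (C : klinCat k) (Sigma : automorphism C) (d : nat).
Variable (Theta : dseq Sigma d -> Prop).
Hypotheses (hd : (1 <= d)%N) (Cadd : additive_cat C) (CKS : krull_schmidt C)
  (Cang : angulated Theta).
Implicit Types (X Y Z M : C) (A B : dseq Sigma d).

Section RetractSeq.
Variables (A : dseq Sigma d) (U : nat -> C) (u : forall i, hom (U i) (A i))
  (v : forall i, hom (A i) (U i)).
Hypotheses (vu : forall i, v i ∘ u i = idm (U i)) (uvm : is_dseq_mor (fun i => u i ∘ v i)).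

(** The sequence induced on the retracts [U i] of [A i]; when the idempotents
    [u i ∘ v i] form an endomorphism of [A], both [u] and [v] are morphisms of
    sequences. *)
Definition retract_dseq : dseq Sigma d :=
  DSeq (fun i => v i.+1 ∘ mor A i ∘ u i) (fmor Sigma (v 0%N) ∘ conn A ∘ u d.+1).

Lemma retract_dseq_in : @is_dseq_mor _ _ _ _ retract_dseq A u.
Proof.
have [sq sqc] := uvm; split=> [i le|] /=.
  by rewrite !compA sq // -compA -(compA (u i)) vu compm1.
by rewrite !compA -fmor_comp sqc -compA -(compA (u d.+1)) vu compm1.
Qed.

Lemma retract_dseq_out : @is_dseq_mor _ _ _ _ A retract_dseq v.
Proof.
have [sq sqc] := uvm; split=> [i le|] /=.
  by rewrite -!compA -sq // !compA vu comp1m.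
rewrite -!compA -sqc fmor_comp !compA -fmor_comp vu fmor_id.
by rewrite comp1m.
Qed.
End RetractSeq.

(** Both the image and the complement of a split idempotent endomorphism of an
    angle are direct summands of it, hence angles. *)
Lemma angle_complement A (e : forall i, hom (A i) (A i)) (s : forall i, split_idem (e i)) :
  Theta A -> is_dseq_mor e ->
  exists B (w : forall i, hom (B i) (A i)) (q : forall i, hom (A i) (B i)),
    [/\ Theta B, is_dseq_mor w, is_dseq_mor q
      & forall i, q i ∘ w i = idm _ /\ w i ∘ q i = idm _ - e i].
Proof.
move=> TA em; have [sq sqc] := em.
have m1 : is_dseq_mor (fun i => im_in (s i) ∘ im_out (s i)).
  by split=> [i le|]; rewrite !im_idem; [apply: sq | apply: sqc].
have m2 : is_dseq_mor (fun i => co_in (s i) ∘ co_out (s i)).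
  split=> [i le|]; rewrite !co_idem; first by rewrite compBl compBr comp1m compm1 sq.
  by rewrite afunD autN fmor_id compBl compBr comp1m compm1 sqc.
have vu1 i : im_out (s i) ∘ im_in (s i) = idm _ := im_outK (s i).
have vu2 i : co_out (s i) ∘ co_in (s i) = idm _ := co_outK (s i).
exists (retract_dseq (fun i => co_in (s i)) (fun i => co_out (s i))),
  (fun i => co_in (s i)), (fun i => co_out (s i)); split.
- have [[_ Hs _ _] _ _ _] := Cang.
  have /Hs/iffLR/(_ TA)[] // : is_dseq_sum
    (retract_dseq (fun i => im_in (s i)) (fun i => im_out (s i)))
    (retract_dseq (fun i => co_in (s i)) (fun i => co_out (s i))) A.
  exists (fun i => im_in (s i)), (fun i => co_in (s i)); split.
  + exact: retract_dseq_in.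
  + exact: retract_dseq_in.
  + move=> i _; exists (im_out (s i)), (co_out (s i)); split.
    * exact: vu1.
    * exact: vu2.
    * exact: im_co (s i).
    * exact: co_im (s i).
    * by rewrite im_idem co_idem addrC subrK.
- exact: retract_dseq_in.
- exact: retract_dseq_out.
by move=> i; split; [exact: vu2 | exact: co_idem (s i)].
Qed.

Definition dseq_size A : nat := \sum_(i < d.+2) dim (hom (A i) (A i)).

Lemma split_idem0 X : split_idem (0 : hom X X).
Proof.
have [Z Zz] := cid (proj1 Cadd).
apply: (@SplitIdem _ _ X 0 Z X 0 0 (idm X) (idm X));
  rewrite ?comp0l ?comp0r ?compm1 ?subr0 //.
by rewrite (proj2 Zz _ (idm Z)).
Qed.

Lemma split_idem_local X Y (a : hom Y X) (b : hom X Y) : local_end Y ->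
  b ∘ a = idm Y -> split_idem (a ∘ b).
Proof.
move=> loc ba.
have [W /cid[w /cid[q [qw bw qa es]]]] := cid (local_complement Cadd CKS loc ba).
apply: (@SplitIdem _ _ X (a ∘ b) Y W a b w q) => //.
by rewrite -es addrC addKr.
Qed.

(** A map [mor A i] outside the radical restricts to an isomorphism between local
    summands of [A i] and [A i.+1].  They span a direct summand [Y -> Y] of
    [A], cut out by the idempotent [e] below; its complement is the smaller
    angle, with the same end terms since 0 < i and i < d. *)
Lemma reduce_angle A i : Theta A -> (1 <= i < d)%N -> ~ in_rad (mor A i) ->
  exists B (w : forall i, hom (B i) (A i)) (q : forall i, hom (A i) (B i)),
    [/\ Theta B, is_dseq_mor w, is_dseq_mor q
      & forall i, q i ∘ w i = idm _ ] /\
    [/\ w 0%N ∘ q 0%N = idm _, w d.+1 ∘ q d.+1 = idm _ & (dseq_size B < dseq_size A)%N].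
Proof.
move=> TA /andP[i1 id] nr.
have [Y [a [b [loc ba]]]] := not_in_rad_local CKS nr.
pose e : forall j, hom (A j) (A j) :=
  dfwith (dfwith (fun j => 0 : hom (A j) (A j)) (a ∘ (b ∘ mor A i))) (mor A i ∘ a ∘ b).
have ei1 : e i.+1 = mor A i ∘ a ∘ b by rewrite /e dfwith_in.
have ei : e i = a ∘ (b ∘ mor A i).
  by rewrite /e dfwith_out ?dfwith_in // neq_ltn ltnSn orbT.
have ej j : j != i -> j != i.+1 -> e j = 0.
  by move=> n1 n2; rewrite /e !dfwith_out // eq_sym.
have e_d : e d.+1 = 0.
  by apply: ej; rewrite ?eqSS neq_ltn ?ltnS ?id ?(ltnW id) ?orbT.
have e_0 : e 0%N = 0 by apply: ej => //; rewrite eq_sym -lt0n.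
(* The two squares next to [e i] and [e i.+1] commute because consecutive maps
   of an angle compose to zero. *)
have em : is_dseq_mor e.
  split=> [j le|]; last by rewrite e_0 e_d aut0 comp0l comp0r.
  have [->|ji] := eqVneq j i; first by rewrite ei1 ei -!compA.
  have [E|ji1] := eqVneq j i.+1.
    rewrite E ei1 !compA (angle_complex_all hd Cadd Cang) // !comp0l.
    by rewrite ej ?comp0l // gtn_eqF.
  rewrite (ej j) // comp0r; have [E|ji2] := eqVneq j.+1 i.
    subst i; rewrite ei -!compA (angle_complex_all hd Cadd Cang) ?comp0r //.
    exact: ltnW.
  by rewrite ej ?comp0l // eqSS.
have s j : split_idem (e j).
  have [->|ji] := eqVneq j i; first by rewrite ei; apply: split_idem_local.
  have [->|ji1] := eqVneq j i.+1.
    by rewrite ei1; apply: split_idem_local => //; rewrite compA.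
  by rewrite ej //; apply: split_idem0.
have [B [w [q [TB wm qm H]]]] := angle_complement s TA em.
exists B, w, q; split; first by split=> // j; case: (H j).
split.
- by have [_ ->] := H 0%N; rewrite e_0 subr0.
- by have [_ ->] := H d.+1; rewrite e_d subr0.
have id2 : (i < d.+2)%N by rewrite ltnS ltnW // ltnW.
have le j : (dim (hom (B j) (B j)) <= dim (hom (A j) (A j)))%N.
  exact: (proj1 (dim_end_retract (proj1 (H j)))).
rewrite /dseq_size (bigD1 (Ordinal id2)) //= [X in (_ < X)%N](bigD1 (Ordinal id2)) //=.
rewrite -addSn leq_add //; last by apply: leq_sum.
apply: (proj2 (dim_end_retract (proj1 (H i)))).
rewrite (proj2 (H i)) ei => /(canRL (subrK _)).
rewrite -[LHS]addr0 => /addrI/esym z.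
have a0 : a = 0 by rewrite -(compm1 a) -ba compA z comp0l.
by apply: (proj1 loc); rewrite -ba a0 comp0r.
Qed.

(** Remove trivial summands for as long as some inner map is not radical. *)
Lemma minimal_AR_angle A : Theta A -> left_almost_split (mor A 0%N) ->
  right_almost_split (mor A d) ->
  exists B, [/\ AR_angle Theta B, isomorphic (B 0%N) (A 0%N) & isomorphic (B d.+1) (A d.+1)].
Proof.
have [m] := ubnP (dseq_size A); elim: m A => // m IH A lem TA las ras.
have [H|] := pselect (forall i, (1 <= i < d)%N -> in_rad (mor A i)).
  by exists A; split=> //; apply: isomorphic_refl.
move=> /existsNP[i /not_implyP[id nr]].
have [B [w [q [[TB wm qm qw] [wq0 wqd lt]]]]] := reduce_angle TA id nr.
have [|||D [ARD D0 Dd]] := IH B _ TB.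
- by apply: leq_trans lt _; rewrite -ltnS.
- exact: (retract_las wm qm).
- exact: (retract_ras wm qm).
exists D; split=> //.
- by apply: isomorphic_trans D0 _; exists (w 0%N), (q 0%N).
- by apply: isomorphic_trans Dd _; exists (w d.+1), (q d.+1).
Qed.

End Reduce.

(** * Auslander-Reiten angles and Serre functors *)

Lemma socle_iso (k : fieldType) (C : klinCat k) (X X' Z Z' : C)
    (h : hom X Z) (u : hom X' X) (v : hom Z Z') :
  socle_map h -> is_iso u -> is_iso v -> socle_map (v ∘ h ∘ u).
Proof.
move=> [h0 hl hr] [u' [u'u uu']] [v' [v'v vv']]; split.
- move=> e; apply: h0; have -> : h = v' ∘ (v ∘ h ∘ u) ∘ u'.
    by rewrite !compA v'v comp1m -compA uu' compm1.
  by rewrite e comp0r comp0l.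
- move=> M g ng; rewrite -!compA (hl _ (u ∘ g)) ?comp0r // => -[s sE].
  apply: ng; exists (s ∘ u).
  by rewrite -[LHS]comp1m -u'u -!compA (compA g) (compA u) (compA u) sE comp1m.
- move=> M g ng; rewrite !compA (hr _ (g ∘ v)) ?comp0l // => -[s sE].
  apply: ng; exists (v ∘ s).
  by rewrite -[LHS]compm1 -vv' !compA -(compA v s) -(compA v _ v) -(compA s) sE compm1.
Qed.

Section Main.
Variables (k : fieldType) (C : klinCat k) (Sigma : automorphism C) (d : nat).
Variable (Theta : dseq Sigma d -> Prop).
Hypotheses (hd : (1 <= d)%N) (Cadd : additive_cat C) (CKS : krull_schmidt C)
  (Cang : angulated Theta).
Implicit Types (X Y Z M : C) (A B : dseq Sigma d).

(** Auslander-Reiten angles can be moved along isomorphisms of their terms, which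
    turns an end term isomorphic to [X] into one equal to [X]. *)
Lemma AR_angle_replace A i0 X : AR_angle Theta A -> isomorphic X (A i0) ->
  exists B, AR_angle Theta B /\ B i0 = X.
Proof.
move=> ARA XA; pose Y i := if i == i0 then X else A i.
have YA i : exists w : hom (Y i) (A i), is_iso w.
  by rewrite /Y; case: eqP => [->|_]; [exact: XA | exact: isomorphic_refl].
pose w i := projT1 (cid (YA i)); pose wi i := projT2 (cid (YA i)) : is_iso (w i).
pose q i := projT1 (cid (wi i)).
have qw i : q i ∘ w i = idm _ by rewrite /q; case: cid => ? [].
have wq i : w i ∘ q i = idm _ by rewrite /q; case: cid => ? [].
have m : is_dseq_mor (fun i => w i ∘ q i).
  by split=> [i le|]; rewrite !wq ?fmor_id ?comp1m ?compm1.
pose B := retract_dseq w q; exists B; split; last by rewrite /B /= /Y eqxx.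
have qm : is_dseq_mor (A := A) (B := B) q by exact: retract_dseq_out.
apply: (retract_AR (A := A) (B := B) (w := w) (q := q)) => //.
  exact: retract_dseq_in.
have [[/(_ A B) H _ _ _] _ _ _] := Cang; apply: H; last by case: ARA.
by exists q; split=> // i _; exists (w i).
Qed.

(** Complete the socle map of the pair to an angle in which it is the connecting
    morphism, then make the inner maps radical. *)
Lemma AR_angle_of_pair X Z : local_end X -> serre_paired X Z ->
  exists A, [/\ AR_angle Theta A, isomorphic (A d.+1) X & isomorphic (Sigma (A 0%N)) Z].
Proof.
move=> loc [phi P]; have [h hs] := pair_socle P loc.
have [K [u [v [TK ui vi sq]]]] := angle_with_conn Cang h.
have [v' [v'i v'v vv']] := iso_inv vi.
have /(socle_almost_split hd Cadd Cang TK)[las ras] : socle_map (conn K).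
  have -> : conn K = v' ∘ h ∘ u by rewrite -compA -sq compA v'v comp1m.
  exact: socle_iso.
have [A [ARA A0 Ad]] := minimal_AR_angle hd Cadd CKS Cang TK las ras.
exists A; split=> //; first by apply: isomorphic_trans Ad _; exists u.
apply: isomorphic_trans (_ : isomorphic _ (Sigma (K 0%N))) _; last by exists v.
by have [f fi] := A0; exists (fmor Sigma f); apply: fmor_iso.
Qed.

Lemma AR_angle_paired A : AR_angle Theta A -> serre_paired (A d.+1) (Sigma (A 0%N)).
Proof. by move=> /(AR_linking hd Cadd Cang)/linking_pair. Qed.

Lemma AR_angles_serre : has_AR_angles Theta -> has_serre C.
Proof.
move=> AR; have [O Oz] := proj1 Cadd; apply: pairs_serre.
  apply: (krull_schmidt_ind Cadd CKS) => [X Xz|X loc|X1 X2 X i1 i2 b [Z1 P1] [Z2 P2]].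
  - by exists O; apply: pair_zero.
  - have [[A [/AR_angle_paired P <-]] _] := AR X (local_indec loc).
    by exists (Sigma (A 0%N)).
  - have [Z [j1 [j2 b']]] := proj2 Cadd Z1 Z2.
    by exists Z; apply: pair_biprod b b' P1 P2.
apply: (krull_schmidt_ind Cadd CKS) => [Z Zz|Z loc|Z1 Z2 Z i1 i2 b [X1 P1] [X2 P2]].
- by exists O; apply: pair_zero.
- have iZ := ainv_isomorphic Sigma Z.
  have loc' : local_end (ainv Sigma Z).
    by apply/(aut_local Sigma); apply: local_iso loc; apply: isomorphic_sym.
  have [_ [A [/AR_angle_paired P A0]]] := AR _ (local_indec loc').
  by exists (A d.+1); apply: pair_iso P _; rewrite A0.
- have [X [j1 [j2 b']]] := proj2 Cadd X1 X2.
  by exists X; apply: pair_biprod b' b P1 P2.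
Qed.

(** For an angle that starts at [X], use an object [Y] that is paired with
    [Sigma X]: the angle that ends at [Y] starts at [X]. *)
Lemma serre_AR_angles : has_serre C -> has_AR_angles Theta.
Proof.
move=> [S SS] X /(indec_local Cadd CKS) loc; split.
  have [A [ARA Ad _]] := AR_angle_of_pair loc (serre_serre_paired SS X).
  exact: AR_angle_replace ARA (isomorphic_sym Ad).
have [Y P] := serre_surj SS (Sigma X); have locSX := iffRL (aut_local Sigma X) loc.
have [phi phiP] := P; have locY := iffRL (pair_local phiP) locSX.
have [A [ARA _ A0]] := AR_angle_of_pair locY P.
exact: AR_angle_replace ARA (isomorphic_sym (aut_isomorphic A0)).
Qed.

(** The connecting morphism of an Auslander-Reiten angle from [T] to [X] links [X]
    to [Sigma T].  Desuspending it links [Sigma^-1 X] to [T], so [T] and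
    [S (Sigma^-1 X)] are both paired with [Sigma^-1 X].  Desuspending first is
    what puts [Sigma^-1] inside [S]. *)
Lemma tau_serre (S : functor C) X T : is_serre S -> is_tau Theta X T ->
  isomorphic T (S (ainv Sigma X)).
Proof.
move=> SS [A [ARA <- <-]].
have [u ui] := ainv_isomorphic Sigma (A d.+1).
have [h hE] := aut_full (conn A ∘ u).
have /linking_pair P : linking h.
  apply: (aut_linking (Sigma := Sigma)); rewrite hE -[conn A]comp1m.
  exact: linking_iso (AR_linking hd Cadd Cang ARA) ui (iso_id _).
exact: pair_unique P (serre_serre_paired SS _).
Qed.

End Main.

Theorem theorem1p5 (k : closedFieldType) (d : nat) (hd : (1 <= d)%N)
    (C : klinCat k) (Cadd : additive_cat C) (CKS : krull_schmidt C)
    (Sigma : automorphism C) (Theta : dseq Sigma d -> Prop)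
    (Cang : angulated Theta) :
  (has_AR_angles Theta <-> has_serre C) /\
  (has_AR_angles Theta \/ has_serre C ->
   forall S : functor C, is_serre S ->
   forall X : C, indecomposable X ->
   forall T : C, is_tau Theta X T -> isomorphic T (S (ainv Sigma X))).
Proof.
split; first by split; [exact: AR_angles_serre | exact: serre_AR_angles].
by move=> _ S SS X _ T; apply: tau_serre.
Qed.
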